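(* If OPF-IAL uses the penalty parameter $c=1/\hat\epsilon$, it performs at most $$\mathcal O\Bigg(\left(1+\left\lceil\max\left\{\log_2\left(\tfrac{D}{D_0}\right),\log_2\left(\tfrac{\Pi(p_0)}{I_0}\right)\right\}\right\rceil\right)\left[1+\left\lceil\max\left\{\Pi(p_0),\tfrac{DI_0}{D_0}\right\}\right\rceil\right]\sqrt{\left(\bar L+\tfrac{\|\mathcal A\|^2}{\hat\epsilon}\right)\max\left\{\tfrac{D^2}{\hat\epsilon},\tfrac{\Pi(p_0)D_0D}{I_0\hat\epsilon},\tfrac{D}{\hat\rho}\right\}}\Bigg)$$ resolvent/gradient evaluations to find an $(\hat\epsilon,\hat\rho)$-approximate solution, i.e. a triple $(z,p,r)$ with $$r\in\nabla\psi_s(z)+\partial\psi_n(z)+\mathcal A^*p,\quad\|r\|\le\hat\rho,\quad\|\mathcal Az-b\|\le\hat\epsilon.$$ Hence, if $\hat\rho=\hat\epsilon$, OPF-IAL performs at most $\mathcal O(1/\hat\epsilon)$ total gradient evaluations to find an $(\hat\epsilon,\hat\epsilon)$-approximate solution.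
   Context: Problem: $\min\{\psi(z):=\psi_s(z)+\psi_n(z):\mathcal Az=b\}$, where $\mathbb E$ is a finite-dimensional Euclidean space, $\mathcal A:\mathbb E\to\mathbb R^m$ is a nonzero linear map with adjoint $\mathcal A^*$, $b\in\mathbb R^m$; $\psi_s:\mathbb E\to\mathbb R$ is convex, differentiable with $\bar L$-Lipschitz gradient ($\bar L>0$); $\psi_n$ is closed proper convex with compact convex domain $\operatorname{dom}\psi_n$ of diameter $D$. Standing assumption: there is a pair $(z_*,p_* )$ with $0\in\nabla\psi_s(z_* )+\partial\psi_n(z_* )+\mathcal A^*p_*$ and $\mathcal Az_*=b$. $\mathcal L_c^s(z,p)=\psi_s(z)+\langle p,\mathcal Az-b\rangle+\frac c2\|\mathcal Az-b\|^2$. $\mathcal P_\star$ is the set of maximizers of the dual function $p\mapsto\min_z\{\psi(z)+\langle p,\mathcal Az-b\rangle\}$, and $\Pi(p)=\operatorname{dist}^2(p,\mathcal P_\star)$. Convention: $\log_2 0=-\infty$. OPF-IAL (inputs $z_0\in\operatorname{dom}\psi_n$, $p_0\in\mathbb R^m$, $(\hat\epsilon,\hat\rho)\in\mathbb R^2_{++}$, $c>0$, $I_0>0$): Choose $w_0\in\operatorname{dom}\psi_n$ with $w_0\ne z_0$ and $\nabla\psi_s(w_0)\neq\nabla\psi_s(z_0)$, and set $M_0=\|\nabla\psi_s(z_0)-\nabla\psi_s(w_0)\|/(4\|z_0-w_0\|)$, $D_0=\|z_0-w_0\|$ (if $\psi_s$ is affine, $M_0>0$ is arbitrary and $\bar L$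 is taken large enough that $M_0\le2\bar L$). The method runs cycles $\ell=1,2,\dots$. The first cycle starts from the input primal point $z_0$, each later cycle from the last primal iterate of the previous cycle; the multiplier is reset to the input $p_0$ at the start of each cycle. In cycle $\ell$, for outer iterations $k=1,2,\dots$: run PF-AR with pair $(\mathcal L_c^s(\cdot,p_{k-1}),\psi_n)$, initial point $z_{k-1}$, estimates $M_0,D_0$ and tolerance $\min\{\hat\epsilon/(4D_{\ell-1}),\hat\rho\}$, with output $(z_k,r_k)$; set $p_k=p_{k-1}+c(\mathcal Az_k-b)$; if $k>\lceil2I_{\ell-1}\rceil$, end the cycle, set $D_\ell=2D_{\ell-1}$, $I_\ell=2I_{\ell-1}$ and start cycle $\ell+1$; otherwise, if $\|\mathcal Az_k-b\|\le\hat\epsilon$, stop and output $(z_k,p_k,r_k)$. The subroutine PF-AR is described for a generic pair $(f,h)$, $f$ convex with $L_f$-Lipschitz gradient, $h$ closed proper convex with compact domain (its internal indices are independent of those above). Backtracking$(f,h,\sigma,x,\bar x,M_0)$: for $j=0,1,\dots$ compute $x^{++}=\arg\min_u\langle\nabla f(x),u\rangle+h(u)+\frac{\sigma}{2}\|u-\bar x\|^2+M_j\|u-x\|^2$ and $x^{+}=\arg\min_u\langle\nabla f(x),u\rangle+h(u)+M_j\|u-x\|^2$. If $f(x^{++})-f(x)-\langle\nabla f(x),x^{++}-x\rangle\le\frac{M_j}{2}\|x^{++}-x\|^2$ and $\|\nabla f(x^+)-\nabla f(x)\|\le M_j\|x^+-x\|$, return $(x^{++},x^+,M_j)$; otherwise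 set $M_{j+1}=2M_j$. Inner solver $\mathsf A$ (assumed available): the call $x_s=\mathsf A(f,h,\sigma_s,\bar x_s,x_{s-1})$, started at $x_{s-1}$, approximately minimizes $\phi_s(u)=f(u)+h(u)+\frac{\sigma_s}{2}\|u-\bar x_s\|^2$, whose minimizer is $x_s^*$. After its $k$-th evaluation of $\nabla f$ it has a point $x_s^k\in\operatorname{dom}h$ and an estimate $L_s^k\le c_{\mathsf A}L_f$ ($c_{\mathsf A}$ a universal constant) with $\phi_s(x_s^k)-\phi_s(x_s^* )\le\frac{L_s^k}{k^2}\|x_{s-1}-x_s^*\|^2$. It terminates whenever $k\ge8\sqrt{2L_s^k/\sigma_s}$ and outputs $x_s=x_s^k$. AR-L$(f,h,x_0,\sigma_1,M_0)$: for $s=1,2,\dots$: if $s=1$ set $\bar x_1=x_0$; if $s\ge2$ set $\sigma_s=4\sigma_{s-1}$, $\gamma_s=1-\sigma_{s-1}/\sigma_s$, $\bar x_s=(1-\gamma_s)\bar x_{s-1}+\gamma_sx_{s-1}$. Compute $x_s=\mathsf A(f,h,\sigma_s,\bar x_s,x_{s-1})$, $(x_s^{++},x_s^+,M_s)=$ Backtracking$(f,h,\sigma_s,x_s,\bar x_s,M_{s-1})$, $v_s=2M_s(x_s-x_s^+)-\nabla f(x_s)+\nabla f(x_s^+)$. Stop as soon as $M_s\le\sigma_s$ and output $(x_s^+,v_s,M_s)$. PF-AR (inputs $(f,h)$, $x_0$, $M_0$, $D_0$, $\epsilon$): for $t=1,2,\dots$ set $D_t=4D_{t-1}$, run AR-L$(f,h,x_{t-1},\epsilon/(7D_t),M_{t-1})$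 with output $(x_t,v_t,M_t)$; stop as soon as $\|v_t\|\le\epsilon$ and output $(x_t,v_t)$. Asymptotic convention: $\mathcal O(\cdot)$ is for tolerances tending to zero (say $\hat\epsilon,\hat\rho\in(0,1]$), with implied constants independent of $\hat\epsilon,\hat\rho$. *)

(* Defs.v *)
From HB Require Import structures.
From mathcomp Require Import all_boot all_order all_algebra.
From mathcomp Require Import all_classical all_reals all_analysis.

Set Implicit Arguments.
Unset Strict Implicit.
Unset Printing Implicit Defensive.

Import Order.TTheory GRing.Theory Num.Theory.
Import numFieldNormedType.Exports.

Local Open Scope classical_set_scope.
Local Open Scope ring_scope.

(* [Vector] supplies finite dimensionality; the norm `|x| of the normed module
   is required to be the one induced by the inner product. *)
HB.mixin Record isEuclidean (R : realType) E
    & NormedModule R E & Vector R E := {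
  inner : E -> E -> R;
  innerC : forall x y, inner x y = inner y x;
  innerDl : forall x y z, inner (x + y) z = inner x z + inner y z;
  innerZl : forall (a : R) x y, inner (a *: x) y = a * inner x y;
  normr_inner : forall x, `|x| = Num.sqrt (inner x x)
}.

#[short(type="euclideanType")]
HB.structure Definition Euclidean (R : realType) :=
  {E of isEuclidean R E & NormedModule R E & Vector R E}.

(* The library norm on 'cV[R]_m is the sup norm, so the Euclidean structure
   of R^m is given explicitly. *)
Definition dotv (R : realType) (m : nat) (p q : 'cV[R]_m) : R :=
  \sum_(i < m) p i 0 * q i 0.
Definition norm2 (R : realType) (m : nat) (p : 'cV[R]_m) : R :=
  Num.sqrt (dotv p p).

Section EuclideanCalculus.
Variables (R : realType) (E : euclideanType R).

(* The unique vector representing a linear form on E. *)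
Definition riesz (l : E -> R) : E := xget 0 [set g | forall v, l v = inner g v].

(* Meaningful when f is differentiable at x. *)
Definition grad (f : E -> R) (x : E) : E := riesz ('d f x).

Definition adjoint (m : nat) (A : {linear E -> 'cV[R]_m}) (p : 'cV[R]_m) : E :=
  riesz (fun v => dotv p (A v)).

Definition opnorm (m : nat) (A : {linear E -> 'cV[R]_m}) : R :=
  sup [set norm2 (A v) | v in [set v : E | `|v| <= 1]].

Definition affine (f : E -> R) : Prop :=
  exists (g : E) (a : R), forall x, f x = inner g x + a.

Definition smooth_convex (f : E -> R) (L : R) : Prop :=
  [/\ convex_function setT f, forall x, differentiable f x
    & L.-lipschitz (grad f)].

Definition dom (h : E -> \bar R) : set E := [set x | (h x < +oo)%E].

Definition closed_proper_convex (h : E -> \bar R) : Prop :=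
  [/\ lower_semicontinuous h,
      (forall x, h x != -oo%E) /\ dom h !=set0
    & forall (x y : E) (t : R), 0 <= t <= 1 ->
        (h (t *: x + (1 - t) *: y)%R <= t%:E * h x + (1 - t)%:E * h y)%E].

Definition diameter (K : set E) : R := sup [set `|x - y| | x in K & y in K].

Definition subdiff (h : E -> \bar R) (x : E) : set E :=
  [set g | forall u, (h x + (inner g (u - x))%:E <= h u)%E].

Definition is_argmin (F : E -> \bar R) (x : E) : Prop :=
  forall u, (F x <= F u)%E.

End EuclideanCalculus.

Section Problem.
Variables (R : realType) (E : euclideanType R) (m : nat).
Variables (A : {linear E -> 'cV[R]_m}) (b : 'cV[R]_m).
Variables (psi_s : E -> R) (psi_n : E -> \bar R).

Definition kkt_set (z : E) (p : 'cV[R]_m) : set E :=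
  [set grad psi_s z + g + adjoint A p | g in subdiff psi_n z].

Definition approx_solution (eps rho : R) (z : E) (p : 'cV[R]_m) (r : E) : Prop :=
  [/\ kkt_set z p r, `|r| <= rho & norm2 (A z - b) <= eps].

Definition smooth_auglag (c : R) (p : 'cV[R]_m) (z : E) : R :=
  psi_s z + dotv p (A z - b) + c / 2 * norm2 (A z - b) ^+ 2.

Definition dual (p : 'cV[R]_m) : \bar R :=
  ereal_inf [set ((psi_s z)%:E + psi_n z + (dotv p (A z - b))%:E)%E | z in setT].

Definition dual_solutions : set 'cV[R]_m :=
  [set p | forall q, (dual q <= dual p)%E].

Definition dist2_dual (p : 'cV[R]_m) : R :=
  inf [set norm2 (p - q) | q in dual_solutions] ^+ 2.

End Problem.

(* Numbers of gradient and of resolvent evaluations; the argmin subproblems of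
   the backtracking step are resolvent evaluations. *)
Record evals := Evals { grads : nat; resolvents : nat }.
Definition no_evals : evals := Evals 0 0.
Definition add_evals (m n : evals) : evals :=
  Evals (grads m + grads n) (resolvents m + resolvents n).
Definition total_evals (n : evals) : nat := (grads n + resolvents n)%N.

Section InnerSolver.
Variables (R : realType) (E : euclideanType R).

Definition prox_objective (f : E -> R) (h : E -> \bar R) (sigma : R) (xbar : E)
    (u : E) : \bar R :=
  ((f u + sigma / 2 * `|u - xbar| ^+ 2)%:E + h u)%E.

(* What the inner solver holds after its k-th gradient evaluation: its point,
   its Lipschitz estimate, and the number of resolvents evaluated so far. *)
Record solver_state := SolverState {
  solver_pt : E; solver_est : R; solver_res : nat }.

(* [S f h sigma xbar x k] is the state after k gradient evaluations of the call
   on (f, h, sigma, xbar) started at x. *)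
Definition solver :=
  (E -> R) -> (E -> \bar R) -> R -> E -> E -> nat -> solver_state.

Definition solver_spec (cA : R) (cres : nat) (S : solver) : Prop :=
  forall (f : E -> R) (h : E -> \bar R) (Lf sigma : R) (xbar x : E),
  0 < Lf -> smooth_convex f Lf ->
  closed_proper_convex h -> compact (dom h) ->
  0 < sigma -> dom h xbar -> dom h x ->
  forall k : nat, (0 < k)%N ->
  let st := S f h sigma xbar x k in
  [/\ dom h (solver_pt st),
      solver_est st <= cA * Lf,
      forall xstar, is_argmin (prox_objective f h sigma xbar) xstar ->
        (prox_objective f h sigma xbar (solver_pt st) <=
         prox_objective f h sigma xbar xstar +
         (solver_est st / k%:R ^+ 2 * `|x - xstar| ^+ 2)%:E)%E
    & (solver_res st <= cres * k)%N].

Definition solver_test (S : solver) f h (sigma : R) xbar x (k : nat) : Prop :=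
  8 * Num.sqrt (2 * solver_est (S f h sigma xbar x k) / sigma) <= k%:R.

Definition solver_stops_at (S : solver) f h (sigma : R) xbar x (k : nat) : Prop :=
  [/\ (0 < k)%N, solver_test S f h sigma xbar x k
    & forall j : nat, (0 < j < k)%N -> ~ solver_test S f h sigma xbar x j].

End InnerSolver.

(* Big-step semantics of the method: a derivation is a terminating execution,
   together with its output and the number of evaluations it performs. The
   argmin subproblems are strongly convex and the solver is a function, so an
   execution is determined by its inputs: existence of a derivation means that
   the method terminates. *)

Section PF_AR.
Variables (R : realType) (E : euclideanType R) (S : solver E).
Variables (f : E -> R) (h : E -> \bar R).

Definition bt_pp (sigma : R) (x xbar : E) (M : R) : E -> Prop :=
  is_argmin (fun u => ((inner (grad f x) u + sigma / 2 * `|u - xbar| ^+ 2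
                        + M * `|u - x| ^+ 2)%:E + h u)%E).

Definition bt_p (x : E) (M : R) : E -> Prop :=
  is_argmin (fun u => ((inner (grad f x) u + M * `|u - x| ^+ 2)%:E + h u)%E).

Definition bt_test (x xpp xp : E) (M : R) : Prop :=
  f xpp - f x - inner (grad f x) (xpp - x) <= M / 2 * `|xpp - x| ^+ 2 /\
  `|grad f xp - grad f x| <= M * `|xp - x|.

(* [backtracking sigma x xbar M xpp xp M' n]: started with estimate M, the
   procedure returns (xpp, xp, M') after n trials. *)
Inductive backtracking (sigma : R) (x xbar : E) :
    R -> E -> E -> R -> nat -> Prop :=
| bt_accept M xpp xp of
    bt_pp sigma x xbar M xpp & bt_p x M xp & bt_test x xpp xp M :
    backtracking sigma x xbar M xpp xp M 1
| bt_double M ypp yp xpp xp M' n of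
    bt_pp sigma x xbar M ypp & bt_p x M yp & ~ bt_test x ypp yp M
    & backtracking sigma x xbar (2 * M) xpp xp M' n :
    backtracking sigma x xbar M xpp xp M' n.+1.

Definition arl_v (x xp : E) (M : R) : E :=
  (2 * M) *: (x - xp) - grad f x + grad f xp.

(* One pass: the solver call (k gradients), then the backtracking call:
   grad f at x once, and in each of its n trials grad f at the trial x^+ and
   two resolvents. *)
Definition arl_step (sigma : R) (xbar x0 : E) (M0 : R)
    (x xp v : E) (M : R) (cost : evals) : Prop :=
  exists (k n : nat) (xpp : E),
  [/\ solver_stops_at S f h sigma xbar x0 k,
      x = solver_pt (S f h sigma xbar x0 k),
      backtracking sigma x xbar M0 xpp xp M n,
      v = arl_v x xp M
    & cost = Evals (k + n.+1)
               (solver_res (S f h sigma xbar x0 k) + 2 * n)].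

(* Arguments sigma_s, \bar x_s, x_{s-1}, M_{s-1}, then output and cost. *)
Inductive arl_loop : R -> E -> E -> R -> E -> E -> R -> evals -> Prop :=
| arl_stop sigma xbar x0 M0 x xp v M cost of
    arl_step sigma xbar x0 M0 x xp v M cost & M <= sigma :
    arl_loop sigma xbar x0 M0 xp v M cost
| arl_next sigma xbar x0 M0 x xp v M cost yp w M' cost' of
    arl_step sigma xbar x0 M0 x xp v M cost & ~ (M <= sigma)
    & (let sigma' := 4 * sigma in
       let gamma := 1 - sigma / sigma' in
       arl_loop sigma' ((1 - gamma) *: xbar + gamma *: x) x M yp w M' cost') :
    arl_loop sigma xbar x0 M0 yp w M' (add_evals cost cost').

Definition arl (x0 : E) (sigma1 M0 : R) : E -> E -> R -> evals -> Prop :=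
  arl_loop sigma1 x0 x0 M0.

(* Arguments x_{t-1}, M_{t-1}, D_{t-1}, then output and cost. *)
Inductive pfar_loop (eps : R) : E -> R -> R -> E -> E -> evals -> Prop :=
| pfar_stop x0 M0 D0 x v M cost of
    arl x0 (eps / (7 * (4 * D0))) M0 x v M cost & `|v| <= eps :
    pfar_loop eps x0 M0 D0 x v cost
| pfar_next x0 M0 D0 x v M cost y w cost' of
    arl x0 (eps / (7 * (4 * D0))) M0 x v M cost & ~ (`|v| <= eps)
    & pfar_loop eps x M (4 * D0) y w cost' :
    pfar_loop eps x0 M0 D0 y w (add_evals cost cost').

Definition pfar (x0 : E) (M0 D0 eps : R) : E -> E -> evals -> Prop :=
  pfar_loop eps x0 M0 D0.

End PF_AR.

Section OPF_IAL.
Variables (R : realType) (E : euclideanType R) (m : nat) (S : solver E).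
Variables (A : {linear E -> 'cV[R]_m}) (b : 'cV[R]_m).
Variables (psi_s : E -> R) (psi_n : E -> \bar R).
Variables (p0 : 'cV[R]_m) (eps rho c M0 D0 : R).

Definition opf_pfar (D : R) (z : E) (p : 'cV[R]_m) : E -> E -> evals -> Prop :=
  pfar S (smooth_auglag A b psi_s c p) psi_n z M0 D0
    (Num.min (eps / (4 * D)) rho).

Definition new_multiplier (p : 'cV[R]_m) (z : E) : 'cV[R]_m :=
  p + c *: (A z - b).

Definition cycle_over (I : R) (k : nat) : Prop :=
  (Num.ceil (2 * I) < k%:Z)%R.

(* Arguments D_{l-1}, I_{l-1}, k, z_{k-1}, p_{k-1} of the current cycle, then
   output and cost. *)
Inductive opf_loop : R -> R -> nat -> E -> 'cV[R]_m ->
    E -> 'cV[R]_m -> E -> evals -> Prop :=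
| opf_new_cycle D I k z p z' r' cost z1 p1 r1 cost1 of
    opf_pfar D z p z' r' cost & cycle_over I k
    & opf_loop (2 * D) (2 * I) 1 z' p0 z1 p1 r1 cost1 :
    opf_loop D I k z p z1 p1 r1 (add_evals cost cost1)
| opf_stop D I k z p z' r' cost of
    opf_pfar D z p z' r' cost & ~ cycle_over I k
    & norm2 (A z' - b) <= eps :
    opf_loop D I k z p z' (new_multiplier p z') r' cost
| opf_next D I k z p z' r' cost z1 p1 r1 cost1 of
    opf_pfar D z p z' r' cost & ~ cycle_over I k
    & ~ (norm2 (A z' - b) <= eps)
    & opf_loop D I k.+1 z' (new_multiplier p z') z1 p1 r1 cost1 :
    opf_loop D I k z p z1 p1 r1 (add_evals cost cost1).

(* The two extra gradients are those in the definition of M0. *)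
Definition opf_ial (I0 : R) (z0 z : E) (p : 'cV[R]_m) (r : E) (cost : evals)
    : Prop :=
  exists2 cost', opf_loop D0 I0 1 z0 p0 z p r cost'
    & cost = add_evals (Evals 2 0) cost'.

End OPF_IAL.

Definition initial_estimate (R : realType) (E : euclideanType R)
    (psi_s : E -> R) (z0 w0 : E) (Lbar M0 : R) : Prop :=
  (grad psi_s w0 <> grad psi_s z0 /\
   M0 = `|grad psi_s z0 - grad psi_s w0| / (4 * `|z0 - w0|)) \/
  (affine psi_s /\ 0 < M0 <= 2 * Lbar).

(* [lne 0 = -oo] in the library. *)
Definition log2 (R : realType) (x : R) : \bar R :=
  (lne x%:E * ((ln 2)^-1)%:E)%E.

Definition ceilR (R : realType) (x : R) : R := (Num.ceil x)%:~R.

(* The argument of O(.); P stands for Pi(p_0). The maximum of the logarithms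
   is finite because D > 0. *)
Definition opf_bound (R : realType) (D D0 P I0 Lbar nA eps rho : R) : R :=
  (1 + ceilR (fine (maxe (log2 (D / D0)) (log2 (P / I0))))) *
  (1 + ceilR (Num.max P (D * I0 / D0))) *
  Num.sqrt ((Lbar + nA ^+ 2 / eps) *
            Num.max (Num.max (D ^+ 2 / eps) (P * D0 * D / (I0 * eps)))
                    (D / rho)).

(* Main.v *)
Require Import Defs.
From HB Require Import structures.
From mathcomp Require Import all_boot all_order all_algebra.
From mathcomp Require Import all_classical all_reals all_analysis.
From mathcomp Require Import ring lra zify.
Set Implicit Arguments.
Unset Strict Implicit.
Unset Printing Implicit Defensive.

Import Order.TTheory GRing.Theory Num.Theory.
Import numFieldNormedType.Exports.

Local Open Scope classical_set_scope.
Local Open Scope ring_scope.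

(** The constant of the bound may depend on all the data but the tolerances, and the
    bound itself is at least a positive multiple of
    [tolerance_rate eps rho = sqrt (eps^-1 * max eps^-1 rho^-1)] ([opf_bound_ge]).
    So it suffices to bound the evaluations of every execution by such a multiple,
    and to show that an execution exists.

    Outer loop. With the penalty [eps^-1], one multiplier step decreases the squared
    distance to a fixed optimal multiplier [ps] by more than [1] as long as the
    constraint is violated by more than [eps], up to an error [D / (2 * D')] due to
    the inexact inner solution ([multiplier_step]). Once the guess [D'] reaches the
    diameter [D] and the guess of the number of iterations reaches
    [norm2 (p0 - ps) ^+ 2 + 1], a cycle must stop by itself. Both guesses double, so
    the number of cycles, and then of calls of the inner method, is bounded
    independently of the tolerances.

    Inner method. The augmented Lagrangian has a gradient with Lipschitz constant
    [L = Lbar + eps^-1 * K ^+ 2]. A pass of the accumulative regularization brings the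
    iterate eight times closer to the regularized minimizer while the
    regularization is multiplied by four only; the potential [arl_potential], which
    is at most [9 / 4 * sigma * D] at the start with regularization [sigma], does
    therefore not increase. It controls the final residual, so that a call with
    [sigma = eps' / (7 * D')] succeeds for tolerance [eps'] as soon as [D'] reaches
    the diameter ([arl_spec]). The costs of the passes, of order [sqrt (L / sigma)],
    form a geometric series ([arl_loop_spec]), and the trials of the backtracking
    are charged to the increase of the estimate, which stays below [4 * L].

    A call hence costs a multiple of [sqrt (L / eps')] plus a multiple of [L]. Since
    [L] is of order [eps^-1] and [eps'] of order [min eps rho], both are of the order
    of the tolerance rate ([opf_ial_complexity]). *)

(** * Inner product algebra and the Riesz representation *)

Section InnerAlgebra.
Variables (R : realType) (E : euclideanType R).
Implicit Types (x y z g : E) (a : R).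

Lemma innerDr x y z : inner x (y + z) = inner x y + inner x z.
Proof. by rewrite innerC innerDl innerC [inner z x]innerC. Qed.

Lemma innerZr a x y : inner x (a *: y) = a * inner x y.
Proof. by rewrite innerC innerZl innerC. Qed.

Lemma innerNl x y : inner (- x) y = - inner x y.
Proof. by rewrite -scaleN1r innerZl mulN1r. Qed.

Lemma innerNr x y : inner x (- y) = - inner x y.
Proof. by rewrite innerC innerNl innerC. Qed.

Lemma inner0l y : inner 0 y = 0.
Proof. by rewrite -(scale0r 0) innerZl mul0r. Qed.

Lemma inner_suml n (F : 'I_n -> E) y :
  inner (\sum_i F i) y = \sum_i inner (F i) y.
Proof.
exact: (big_morph (fun x => inner x y) (fun u v => innerDl u v y) (inner0l y)).
Qed.

Lemma inner_sumr n (F : 'I_n -> E) y :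
  inner y (\sum_i F i) = \sum_i inner y (F i).
Proof. by rewrite innerC inner_suml; apply: eq_bigr => i _; rewrite innerC. Qed.

Definition innerE :=
  (@innerDl R E, innerDr, innerNl, innerNr, @innerZl R E, innerZr).

Lemma inner_ge0 x : 0 <= inner x x.
Proof.
have [//|lt0] := leP 0 (inner x x).
have /eqP : `|x| = 0 by rewrite normr_inner ler0_sqrtr// ltW.
by rewrite normr_eq0 => /eqP x0; move: lt0; rewrite x0 inner0l ltxx.
Qed.

Lemma normr2E x : `|x| ^+ 2 = inner x x.
Proof. by rewrite normr_inner sqr_sqrtr// inner_ge0. Qed.

(** The discriminant argument behind every Cauchy-Schwarz inequality. *)
Lemma discriminant_le (u v w : R) :
  (forall t : R, 0 <= u + 2 * t * v + t ^+ 2 * w) -> 0 <= w -> v ^+ 2 <= u * w.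
Proof.
move=> H; rewrite le0r => /predU1P[w0|w0].
  have [->|v0] := eqVneq v 0; first by rewrite w0 mulr0 expr0n.
  have := H (- (u + 1) / (2 * v)); rewrite w0 mulr0 addr0.
  have -> : u + 2 * (- (u + 1) / (2 * v)) * v = - 1 by field.
  by rewrite lerNr oppr0 ler10.
have := H (- v / w).
have -> : u + 2 * (- v / w) * v + (- v / w) ^+ 2 * w = (u * w - v ^+ 2) / w.
  by field; rewrite gt_eqF.
by rewrite pmulr_lge0 ?invr_gt0// subr_ge0.
Qed.

Lemma ler_of_sqr (x y : R) : 0 <= y -> x ^+ 2 <= y ^+ 2 -> x <= y.
Proof.
move=> y0 h; have [x0|x0] := leP x 0; first exact: le_trans y0.
by rewrite -(@ler_sqr R)// nnegrE// ltW.
Qed.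

Lemma cauchy_schwarz x y : inner x y <= `|x| * `|y|.
Proof.
apply: ler_of_sqr; first exact: mulr_ge0.
rewrite exprMn !normr2E; apply: discriminant_le (inner_ge0 y) => t.
by have := inner_ge0 (x + t *: y); rewrite !innerE [inner y x]innerC; lra.
Qed.

End InnerAlgebra.

Section Riesz.
Variables (R : realType) (E : euclideanType R).

Lemma riesz_unique (l : E -> R) (g : E) :
  (forall v, l v = inner g v) -> riesz l = g.
Proof.
move=> lg; apply: xget_unique => //= y ly.
apply/eqP; rewrite -subr_eq0 -normr_eq0 -sqrf_eq0 normr2E.
by rewrite innerDl innerNl -ly -lg subrr.
Qed.

Let n := \dim {: E}.
Let e (i : 'I_n) : E := (vbasis {: E})`_i.

(** The Gram operator of a basis. It is injective, hence onto, and a preimage of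
    [\sum_i l (e i) *: e i] represents [l]. *)
Let gram (g : E) : E := \sum_(i < n) inner g (e i) *: e i.

Let gram_linear : linear gram.
Proof.
move=> a x y; rewrite /gram scaler_sumr -big_split; apply: eq_bigr => i _.
by rewrite /= innerDl innerZl scalerDl scalerA.
Qed.

HB.instance Definition _ := GRing.isLinear.Build R E E _ gram gram_linear.

Let basis_coords0 (k : 'I_n -> R) : \sum_(i < n) k i *: e i = 0 -> forall i, k i = 0.
Proof. by apply/freeP; exact: basis_free (vbasisP _). Qed.

Lemma riesz_exists (l : E -> R) : linear_for *%R l -> exists g, forall v, l v = inner g v.
Proof.
move=> lin_l.
have l0 : l 0 = 0 by have := lin_l (-1) 0 0; rewrite scaler0 addr0 mulN1r addNr.
have ker0 : lker (linfun gram) == 0%VS.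
  apply/lker0P => x y; rewrite !lfunE /= => /eqP; rewrite -subr_eq0 => /eqP gxy.
  have {gxy} : \sum_(i < n) inner (x - y) (e i) *: e i = 0.
    rewrite -[RHS]gxy /gram -sumrB; apply: eq_bigr => i _.
    by rewrite innerDl innerNl scalerBl.
  move=> /basis_coords0 xy0; apply/eqP; rewrite -subr_eq0 -normr_eq0 -sqrf_eq0.
  rewrite normr2E {2}(coord_vbasis (memvf (x - y))) inner_sumr big1// => i _.
  by rewrite innerZr xy0 mulr0.
pose g := ((linfun gram)^-1)%VF (\sum_(i < n) l (e i) *: e i); exists g => v.
have : linfun gram g = \sum_(i < n) l (e i) *: e i by rewrite lker0_lfunVK.
rewrite lfunE /= => /eqP; rewrite -subr_eq0 /gram -sumrB => /eqP ge.
have gl : \sum_(i < n) (inner g (e i) - l (e i)) *: e i = 0.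
  by rewrite -[RHS]ge; apply: eq_bigr => i _; rewrite scalerBl.
have gE i : inner g (e i) = l (e i).
  apply/eqP; rewrite -subr_eq0; apply/eqP; exact: (basis_coords0 gl).
rewrite (coord_vbasis (memvf v)) inner_sumr.
have -> : l (\sum_(i < n) coord (vbasis {: E}) i v *: e i) =
          \sum_(i < n) coord (vbasis {: E}) i v * l (e i).
  elim/big_rec2: _ => // i s1 s2 _ <-; exact: lin_l.
by apply: eq_bigr => i _; rewrite innerZr gE.
Qed.

Lemma rieszE (l : E -> R) : linear_for *%R l -> forall v, l v = inner (riesz l) v.
Proof. by move=> /riesz_exists[g lg] v; rewrite (riesz_unique lg). Qed.

End Riesz.

(** * The constraint map: dot products, adjoint and operator norm *)

Section DotProduct.
Variables (R : realType) (m : nat).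
Implicit Types (p q r : 'cV[R]_m).

Lemma dotvC p q : dotv p q = dotv q p.
Proof. by apply: eq_bigr => i _; rewrite mulrC. Qed.

Lemma dotvDl p q r : dotv (p + q) r = dotv p r + dotv q r.
Proof. by rewrite -big_split; apply: eq_bigr => i _; rewrite mxE mulrDl. Qed.

Lemma dotvZl a p q : dotv (a *: p) q = a * dotv p q.
Proof. by rewrite /dotv mulr_sumr; apply: eq_bigr => i _; rewrite mxE mulrA. Qed.

Lemma dotvDr p q r : dotv r (p + q) = dotv r p + dotv r q.
Proof. by rewrite ![dotv r _]dotvC dotvDl. Qed.

Lemma dotvZr a p q : dotv p (a *: q) = a * dotv p q.
Proof. by rewrite ![dotv p _]dotvC dotvZl. Qed.

Lemma dotvNl p q : dotv (- p) q = - dotv p q.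
Proof. by rewrite -scaleN1r dotvZl mulN1r. Qed.

Lemma dotvNr p q : dotv p (- q) = - dotv p q.
Proof. by rewrite -scaleN1r dotvZr mulN1r. Qed.

Definition dotvE := (dotvDl, dotvDr, dotvNl, dotvNr, dotvZl, dotvZr).

Lemma dotv_ge0 p : 0 <= dotv p p.
Proof. by apply: sumr_ge0 => i _; rewrite -expr2 sqr_ge0. Qed.

Lemma norm2_ge0 p : 0 <= norm2 p.
Proof. exact: sqrtr_ge0. Qed.

Lemma norm2_sqr p : norm2 p ^+ 2 = dotv p p.
Proof. by rewrite sqr_sqrtr// dotv_ge0. Qed.

Lemma norm2Z a p : 0 <= a -> norm2 (a *: p) = a * norm2 p.
Proof.
move=> a0; rewrite /norm2 dotvZl dotvZr mulrA -expr2 sqrtrM ?sqr_ge0//.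
by rewrite sqrtr_sqr ger0_norm.
Qed.

Lemma dotv_cauchy_schwarz p q : dotv p q <= norm2 p * norm2 q.
Proof.
apply: ler_of_sqr; first by rewrite mulr_ge0// norm2_ge0.
rewrite exprMn !norm2_sqr; apply: discriminant_le (dotv_ge0 q) => t.
by have := dotv_ge0 (p + t *: q); rewrite !dotvE [dotv q p]dotvC; lra.
Qed.

End DotProduct.

Section Adjoint.
Variables (R : realType) (E : euclideanType R) (m : nat).
Variable (A : {linear E -> 'cV[R]_m}).

Lemma adjointE p v : inner (adjoint A p) v = dotv p (A v).
Proof.
rewrite -(@rieszE _ _ (fun v => dotv p (A v)))// => a x y.
by rewrite linearP dotvDr dotvZr.
Qed.

Lemma linear_norm2_bounded : exists2 K, 0 < K & forall v, norm2 (A v) <= K * `|v|.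
Proof.
pose a i := adjoint A (\col_j (j == i)%:R).
have aE i v : inner (a i) v = A v i 0.
  rewrite adjointE /dotv (bigD1 i)//= mxE eqxx mul1r big1 ?addr0// => j ji.
  by rewrite mxE (negbTE ji) mul0r.
exists (1 + \sum_i `|a i|); first by rewrite ltr_pwDl// sumr_ge0.
move=> v; apply: ler_of_sqr.
  by rewrite mulr_ge0// addr_ge0// sumr_ge0.
rewrite exprMn norm2_sqr.
have le1 : dotv (A v) (A v) <= \sum_i `|a i| ^+ 2 * `|v| ^+ 2.
  apply: ler_sum => i _; rewrite -aE -expr2 -exprMn -ler_sqrt ?sqr_ge0//.
  rewrite !sqrtr_sqr [leRHS]ger0_norm ?mulr_ge0// ler_norml cauchy_schwarz.
  by rewrite andbT lerNl -innerNl -(normrN (a i)) cauchy_schwarz.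
apply: le_trans le1 _; rewrite -mulr_suml ler_wpM2r ?sqr_ge0//.
have : \sum_i `|a i| ^+ 2 <= (\sum_i `|a i|) ^+ 2.
  rewrite expr2 mulr_suml; apply: ler_sum => i _; rewrite expr2 ler_wpM2l//.
  by rewrite (bigD1 i)//= lerDl sumr_ge0.
have : 0 <= \sum_i `|a i| by rewrite sumr_ge0.
set s := \sum_i `|a i|; lra.
Qed.

Lemma opnorm_gt0 : (exists z, A z <> 0) -> 0 < opnorm A.
Proof.
move=> [z Az0]; have [K K0 AK] := linear_norm2_bounded.
have z0 : `|z| != 0.
  by apply: contra_notN Az0; rewrite normr_eq0 => /eqP ->; rewrite linear0.
apply: (@lt_le_trans _ _ (norm2 (A (`|z|^-1 *: z)))).
  rewrite lt_def norm2_ge0 andbT linearZ norm2Z// mulf_neq0 ?invr_eq0//.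
  apply: contra_notN Az0; rewrite -sqrf_eq0 norm2_sqr /dotv.
  rewrite psumr_eq0; last by move=> i _; rewrite -expr2 sqr_ge0.
  move=> /allP Az; apply/matrixP => i j; rewrite ord1 mxE; apply/eqP.
  by move: (Az i (mem_index_enum i)); rewrite /= mulf_eq0 orbb.
apply: ub_le_sup; last first.
  exists (`|z|^-1 *: z) => //=; rewrite normrZ normfV normr_id mulVf//.
exists K => _ [v /= v1 <-]; apply: le_trans (AK v) _.
by rewrite -[leRHS]mulr1 ler_wpM2l// ltW.
Qed.

End Adjoint.

(** * Gradients of convex functions *)

Section Gradient.
Variables (R : realType) (E : euclideanType R).
Implicit Types (f : E -> R) (g x y v : E).

Lemma gradE f x v : 'd f x v = inner (grad f x) v.
Proof. by rewrite -rieszE// => a u w; rewrite linearP. Qed.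

Lemma inner_linear g : linear_for *%R (inner g).
Proof. by move=> a x y; rewrite !innerE. Qed.

HB.instance Definition _ g :=
  GRing.isLinear.Build R E R *%R (inner g) (inner_linear g).

Lemma inner_continuous g : continuous (inner g).
Proof.
apply/linear_bounded_continuous; apply/ex_bound; exists `|g|.
near=> v => /=; rewrite ler_norml.
have v1 : `|v| <= 1.
  by near: v; apply/nbhs_norm0P; exists 1 => //= v /= /ltW.
rewrite lerNl -innerNl.
have le u : `|u| = `|g| -> inner u v <= `|g|.
  move=> <-; apply: le_trans (cauchy_schwarz _ _) _.
  by rewrite -[leRHS]mulr1 ler_wpM2l.
by rewrite !le ?normrN.
Unshelve. all: by end_near. Qed.

(** A first order expansion with a quadratic remainder identifies the gradient;
    all the smooth functions here have one. *)
Lemma quadratic_expansion_grad f g x K :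
  (forall v, `|f (v + x) - f x - inner g v| <= K * `|v| ^+ 2) ->
  differentiable f x /\ grad f x = g.
Proof.
move=> fK.
have fo : f \o shift x = cst (f x) + (inner g : E -> R) +o_ 0 id.
  apply/eqaddoP => _/posnumP[e]; have [K0|K0] := leP K 0; near=> v.
    rewrite /= opprD addrA; apply: le_trans (fK v) _.
    by rewrite (le_trans (mulr_le0_ge0 K0 (sqr_ge0 _)))// mulr_ge0.
  rewrite /= opprD addrA; apply: le_trans (fK v) _.
  rewrite expr2 mulrA ler_wpM2r// -ler_pdivlMl//.
  near: v; apply/nbhs_norm0P; exists (K^-1 * e%:num) => [|v /= /ltW//].
  by rewrite /= mulr_gt0// invr_gt0.
have dE : 'd f x = (inner g : {linear E -> R}) :> (E -> R).
  by apply: diff_unique => //; exact: inner_continuous.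
split; last by apply: riesz_unique => v; rewrite dE.
by apply/diff_locallyP; rewrite dE; split => //; exact: inner_continuous.
Unshelve. all: by end_near. Qed.

Lemma convex_functionP f : convex_function setT f ->
  forall x y t, 0 <= t <= 1 ->
  f (t *: x + (1 - t) *: y) <= t * f x + (1 - t) * f y.
Proof.
move=> cf x y t /andP[t0 t1].
have := cf (Itv01 t0 t1) x y; rewrite !inE => /(_ I I).
by rewrite convRE.
Qed.

Lemma convex_functionI f :
  (forall x y t, 0 <= t <= 1 ->
   f (t *: x + (1 - t) *: y) <= t * f x + (1 - t) * f y) ->
  convex_function setT f.
Proof. by move=> cf t x y _ _; apply: cf; rewrite ge0 le1. Qed.

(** The difference quotients at [x] along [y - x] are below [f y - f x] by
    convexity, and their limit is the directional derivative. *)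
Lemma convex_grad f x y : convex_function setT f -> differentiable f x ->
  f x + inner (grad f x) (y - x) <= f y.
Proof.
move=> /convex_functionP cf df.
rewrite -lerBrDl -gradE -deriveE//.
have dv : derivable f x (y - x) by exact: diff_derivable.
have cv := cvg_dnbhs_at_right dv.
have near0 : \forall t \near 0^'+, t^-1 *: ((f \o shift x) (t *: (y - x)) - f x) <= f y - f x.
  near=> t.
  have t0 : 0 < t by near: t; exact: nbhs_right_gt.
  have t1 : t <= 1 by near: t; exact: nbhs_right_le.
  rewrite /= -[leLHS]/(t^-1 * _) ler_pdivrMl//.
  have -> : t *: (y - x) + x = t *: y + (1 - t) *: x.
    by rewrite scalerBr scalerBl scale1r addrAC addrA.
  have := cf y x t; rewrite (ltW t0) t1 => /(_ isT); lra.
rewrite /derive -(cvg_lim _ cv)//.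
by apply: limr_le near0; exact: cvgP cv.

Unshelve. all: by end_near. Qed.

End Gradient.

(** * Minimizing strongly convex functions over a compact domain *)

Section StrongConvexity.
Variables (R : realType) (E : euclideanType R).
Implicit Types (f q : E -> R) (x y z g : E).

(** The chord form of strong convexity, which covers nondifferentiable objectives
    and adds up. *)
Definition strongly_convex (mu : R) q : Prop := forall x y t, 0 <= t <= 1 ->
  q (t *: x + (1 - t) *: y) <=
  t * q x + (1 - t) * q y - mu / 2 * (t * (1 - t)) * `|x - y| ^+ 2.

Lemma strongly_convexD mu nu q f : strongly_convex mu q ->
  strongly_convex nu f -> strongly_convex (mu + nu) (fun u => q u + f u).
Proof. by move=> cq cf x y t t01; have := cq x y t t01; have := cf x y t t01; lra. Qed.

Lemma strongly_convex_inner g : strongly_convex 0 (inner g).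
Proof. by move=> x y t _; rewrite !innerE; lra. Qed.

Lemma strongly_convex_smooth f : convex_function setT f -> strongly_convex 0 f.
Proof. by move=> /convex_functionP cf x y t t01; have := cf x y t t01; lra. Qed.

Lemma strongly_convex_sqr M z : strongly_convex (2 * M) (fun u => M * `|u - z| ^+ 2).
Proof.
move=> x y t _; rewrite !normr2E !innerE [inner y x]innerC.
by rewrite [inner z x]innerC [inner z y]innerC; lra.
Qed.

Lemma sqr_dist_continuous z : continuous (fun u : E => `|u - z| ^+ 2).
Proof.
move=> u; apply: (@continuous_comp _ _ _ (fun u => `|u - z|) (fun r => r ^+ 2)).
  apply: (@continuous_comp _ _ _ (fun u => u - z) (fun r => `|r|)).
    by apply: cvgB; [exact: cvg_id|exact: cvg_cst].
  exact: norm_continuous.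
exact: exprn_continuous.
Qed.

End StrongConvexity.

Lemma le_of_perturbation (R : realType) (a b c : R) :
  (forall t, 0 < t < 1 -> a + (1 - t) * b <= c) -> a + b <= c.
Proof.
move=> H; rewrite leNgt; apply/negP => abc.
have [b0|b0] := leP b 0.
  have : 0 < (2^-1 : R) < 1 by apply/andP; split; lra.
  by move=> /H; lra.
pose d := a + b - c; have d0 : 0 < d by rewrite subr_gt0.
have bd : 0 < 2 * (b + d) by rewrite mulr_gt0// addr_gt0.
have := H (d / (2 * (b + d))).
rewrite divr_gt0// ltr_pdivrMr// mul1r => /(_ ltac:(lra)).
have : d / (2 * (b + d)) * b < d.
  by rewrite mulrAC ltr_pdivrMr// ltr_pM2l//; lra.
by rewrite /d; lra.
Qed.

Section CompactMinimization.
Variables (R : realType) (E : euclideanType R) (h : E -> \bar R).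
Hypothesis h_cvx : closed_proper_convex h.
Hypothesis h_compact : compact (dom h).
Implicit Types (q f : E -> R) (x y z u g : E).

Let H x := fine (h x).

Lemma dom_fine x : dom h x -> h x = (H x)%:E.
Proof.
have [_ [hN _] _] := h_cvx => hx; rewrite /H fineK// fin_numE hN /=.
by rewrite lt_eqF.
Qed.

Lemma dom_convex x y t : dom h x -> dom h y -> 0 <= t <= 1 ->
  dom h (t *: x + (1 - t) *: y) /\
  H (t *: x + (1 - t) *: y) <= t * H x + (1 - t) * H y.
Proof.
move=> hx hy t01; have [_ _ /(_ x y t t01)] := h_cvx.
rewrite (dom_fine hx) (dom_fine hy) -!EFinM -EFinD => hle.
have hd : dom h (t *: x + (1 - t) *: y) by exact: le_lt_trans hle (ltry _).
by split=> //; rewrite -lee_fin -(dom_fine hd).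
Qed.

Lemma dom_bounded x y : dom h x -> dom h y -> `|x - y| <= diameter (dom h).
Proof.
move=> hx hy; have [M [_ /(_ (M + 1))]] := compact_bounded h_compact.
rewrite ltrDl ltr01 => /(_ isT) hM.
apply: ub_le_sup; last by exists x => //; exists y.
exists ((M + 1) + (M + 1)) => _ [u hu [v hv <-]].
by apply: le_trans (ler_normB _ _) _; apply: lerD; exact: hM.
Qed.

Lemma not_dom u : ~ dom h u -> h u = +oo%E.
Proof. by move=> /negP; rewrite -leNgt leye_eq => /eqP. Qed.

Lemma argminP q x : is_argmin (fun u => ((q u)%:E + h u)%E) x <->
  dom h x /\ forall u, dom h u -> q x + H x <= q u + H u.
Proof.
split=> [qx|[hx qx] u].
  have hx : dom h x.
    have [_ [_ [u hu]] _] := h_cvx; apply: contrapT => /not_dom hxy.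
    by have := qx u; rewrite hxy (dom_fine hu) -EFinD addeC/= leye_eq.
  by split=> // u hu; have := qx u; rewrite (dom_fine hu) (dom_fine hx) -!EFinD lee_fin.
have [hu|/not_dom ->] := pselect (dom h u); last by rewrite addeC/= leey.
by rewrite (dom_fine hu) (dom_fine hx) -!EFinD lee_fin qx.
Qed.

Lemma subdiffP x g : subdiff h x g <->
  dom h x /\ forall u, dom h u -> H x + inner g (u - x) <= H u.
Proof.
split=> [hg|[hx hg] u].
  have hx : dom h x.
    have [_ [_ [u hu]] _] := h_cvx; apply: contrapT => /not_dom hxy.
    by have := hg u; rewrite hxy (dom_fine hu)/= leye_eq.
  by split=> // u hu; have := hg u; rewrite (dom_fine hu) (dom_fine hx) -EFinD lee_fin.
have [hu|/not_dom ->] := pselect (dom h u); last by rewrite leey.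
by rewrite (dom_fine hu) (dom_fine hx) -EFinD lee_fin hg.
Qed.

Lemma subdiff_monotone x y g k : subdiff h x g -> subdiff h y k ->
  0 <= inner (g - k) (x - y).
Proof.
move=> /subdiffP[hx /(_ y)] + /subdiffP[hy /(_ x hx)] => /(_ hy).
by rewrite -(opprB x y) innerNr innerDl innerNl; lra.
Qed.

(** The sublevel sets form a filter base in the compact domain; lower
    semicontinuity makes each of its cluster points a minimizer. *)
Lemma argmin_exists q : continuous q ->
  exists x, is_argmin (fun u => ((q u)%:E + h u)%E) x.
Proof.
move=> cq; have [lsc [hN [w hw]] _] := h_cvx.
pose F u := ((q u)%:E + h u)%E.
have lscF x a : (a%:E < F x)%E ->
    exists2 V, nbhs x V & forall y, V y -> (a%:E < F y)%E.
  move=> aF.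
  have [c [d [cq' dh cd]]] : exists c d, [/\ c < q x, (d%:E < h x)%E & a <= c + d].
    move: aF (hN x); rewrite /F; case: (h x) => [r| |] // aF _.
      rewrite -EFinD lte_fin in aF.
      exists (q x - (q x + r - a) / 2), (r - (q x + r - a) / 2).
      by split; rewrite ?lte_fin; lra.
    by exists (q x - 1), (a - q x + 1); split; rewrite ?ltry//; lra.
  have [V xV hV] := lsc x d dh.
  exists (V `&` [set y | c < q y]); first exact: filterI xV (cvgr_gt _ (cq x) _ cq').
  move=> y [Vy cy]; apply: (@le_lt_trans _ _ (c + d)%:E); first by rewrite lee_fin.
  by rewrite EFinD lteD ?hV// lte_fin.
pose m := ereal_inf (range F).
pose S : set (set E) :=
  filter_from [set a | (m < a%:E)%E] (fun a => [set u | (F u < a%:E)%E]).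
have mF u : (m <= F u)%E by apply: ereal_inf_lbound; exists u.
have Dw : (F w < (q w + H w + 1)%:E)%E.
  by rewrite /F (dom_fine hw) -EFinD lte_fin ltrDl.
have PS : ProperFilter S.
  apply: filter_from_proper => [|a /ereal_inf_lt[_ [u _ <-] ua]]; last by exists u.
  apply: filter_from_filter; first by exists (q w + H w + 1); exact: le_lt_trans Dw.
  move=> i j mi mj; exists (Num.min i j) => [|u]; first by rewrite /= minEle; case: ifP.
  by move=> /= uij; split; apply: lt_le_trans uij _; rewrite lee_fin ge_min lexx ?orbT.
have Sdom : S (dom h).
  exists (q w + H w + 1); first exact: le_lt_trans Dw.
  by move=> u; rewrite /= /F /dom /=; case: (h u) => // r _; rewrite ltry.
have [x [hx Sx]] := h_compact PS Sdom.
exists x => u; apply: (@le_trans _ _ m); last exact: mF.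
rewrite leNgt; apply/negP => mx.
(* a real level strictly between the infimum and the value at x *)
have [a ma ax] : exists2 a : R, (m < a%:E)%E & (a%:E < F x)%E.
  have Fx : F x = (q x + H x)%:E by rewrite /F (dom_fine hx).
  move: mx; rewrite -/(F x) Fx; case: (m) => [r| |]//.
    by rewrite lte_fin => rx; exists ((r + (q x + H x)) / 2); rewrite lte_fin; lra.
  by move=> _; exists (q x + H x - 1); rewrite ?ltNyr// lte_fin; lra.
have [V xV hV] := lscF x a ax.
have Sa : S [set u | (F u < a%:E)%E] by exists a.
have [y [/= ya /hV]] := Sx _ _ Sa xV.
by rewrite ltNge (ltW ya).
Qed.

(** Compare the minimizer [x] with the points of the segment towards [u], and let
    them tend to [x]. *)
Lemma argmin_strong q mu x u : strongly_convex mu q ->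
  is_argmin (fun u => ((q u)%:E + h u)%E) x -> dom h u ->
  q x + H x + mu / 2 * `|u - x| ^+ 2 <= q u + H u.
Proof.
move=> cq /argminP[hx qx] hu; apply: le_of_perturbation => t /andP[t0 t1].
have t01 : 0 <= t <= 1 by rewrite !ltW.
have [hd hle] := dom_convex hu hx t01.
have := cq u x t t01; have := qx _ hd => h1 h2.
have : t * (q x + H x + (1 - t) * (mu / 2 * `|u - x| ^+ 2)) <= t * (q u + H u) by lra.
by rewrite ler_pM2l.
Qed.

End CompactMinimization.

(** * Smooth convex functions and the augmented Lagrangian *)

Section SmoothConvex.
Variables (R : realType) (E : euclideanType R) (f : E -> R) (L : R).
Hypothesis f_smooth : smooth_convex f L.
Implicit Types (x y : E).

Lemma grad_lipschitz x y : `|grad f x - grad f y| <= L * `|x - y|.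
Proof. by have [_ _ lip] := f_smooth; have := lip (x, y); apply. Qed.

Lemma smooth_continuous : continuous f.
Proof.
by have [_ df _] := f_smooth; move=> x; apply: differentiable_continuous (df x).
Qed.

Lemma smooth_grad_le x y : f x + inner (grad f x) (y - x) <= f y.
Proof. by have [cf df _] := f_smooth; apply: convex_grad. Qed.

Lemma grad_monotone x y : 0 <= inner (grad f x - grad f y) (x - y).
Proof.
have := smooth_grad_le x y; have := smooth_grad_le y x.
rewrite -(opprB x y) innerNr innerDl innerNl.
by move: (inner _ (x - y)) (inner _ (x - y)) (f x) (f y) => *; lra.
Qed.

(** The gradient inequality at [y] and the Lipschitz bound give the descent lemma
    with [L] in place of [L / 2]. This spares an integration along the segment and
    costs a factor two in the estimates of the backtracking. *)
Lemma smooth_descent x y :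
  f y - f x - inner (grad f x) (y - x) <= L * `|y - x| ^+ 2.
Proof.
have := ler_wpM2r (normr_ge0 (y - x)) (grad_lipschitz y x).
have := smooth_grad_le y x; have := cauchy_schwarz (grad f y - grad f x) (y - x).
rewrite -(opprB y x) innerNr innerDl innerNl -mulrA -expr2.
move: (inner _ (y - x)) (inner _ (y - x)) (f x) (f y) => *; lra.
Qed.

Lemma backtracking_accepts M x xpp xp : 2 * L <= M -> 0 <= M ->
  bt_test f x xpp xp M.
Proof.
move=> LM M0; split.
  apply: le_trans (smooth_descent _ _) _; rewrite ler_wpM2r ?sqr_ge0//; lra.
apply: le_trans (grad_lipschitz _ _) _; rewrite ler_wpM2r//; lra.
Qed.

End SmoothConvex.

Section AugmentedLagrangian.
Variables (R : realType) (E : euclideanType R) (m : nat).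
Variables (A : {linear E -> 'cV[R]_m}) (b : 'cV[R]_m) (psi_s : E -> R).
Variables (L K c : R) (p : 'cV[R]_m).
Hypothesis psi_s_smooth : smooth_convex psi_s L.
Hypothesis K_ge0 : 0 <= K.
Hypothesis AK : forall v, norm2 (A v) <= K * `|v|.
Hypothesis c_ge0 : 0 <= c.

Lemma adjointB (q r : 'cV[R]_m) : adjoint A (q - r) = adjoint A q - adjoint A r.
Proof.
by apply: riesz_unique => v; rewrite innerDl innerNl !adjointE dotvDl dotvNl.
Qed.

Lemma norm_adjoint (q : 'cV[R]_m) : `|adjoint A q| <= K * norm2 q.
Proof.
have [->|a0] := eqVneq (adjoint A q) 0.
  by rewrite normr0 mulr_ge0// norm2_ge0.
rewrite -(@ler_pM2r _ `|adjoint A q|) ?normr_gt0// -expr2 normr2E adjointE.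
apply: le_trans (dotv_cauchy_schwarz _ _) _.
by rewrite mulrAC mulrC ler_wpM2r ?norm2_ge0.
Qed.

Let f := smooth_auglag A b psi_s c p.

Let norm2_A_sqr v : norm2 (A v) ^+ 2 <= K ^+ 2 * `|v| ^+ 2.
Proof. by rewrite -exprMn ler_sqr ?nnegrE ?norm2_ge0 ?mulr_ge0. Qed.

(** The penalty is quadratic and [psi_s] lies between its tangent and that tangent
    plus a quadratic, so the expansion of the sum has a quadratic remainder. *)
Lemma auglag_grad x : differentiable f x /\
  grad f x = grad psi_s x + adjoint A (p + c *: (A x - b)).
Proof.
apply: (@quadratic_expansion_grad _ _ _ _ _ (L + c / 2 * K ^+ 2)) => v.
have := smooth_descent psi_s_smooth x (v + x).
have := smooth_grad_le psi_s_smooth x (v + x); rewrite addrK.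
have hA := norm2_A_sqr v; have := norm2_ge0 (A v) => A0.
rewrite /f /smooth_auglag innerDl adjointE linearD.
have -> : A v + A x - b = A v + (A x - b) by rewrite addrA.
move: (A x - b) => X; rewrite !norm2_sqr !dotvE [dotv X (A v)]dotvC -norm2_sqr.
have cA : 0 <= c / 2 * norm2 (A v) ^+ 2 <= c / 2 * (K ^+ 2 * `|v| ^+ 2).
  by rewrite mulr_ge0 ?sqr_ge0 ?divr_ge0//= ler_wpM2l// divr_ge0.
by move=> h1 h2; rewrite ler_norml; apply/andP; split; move/andP: cA => [? ?]; lra.
Qed.

Lemma auglag_smooth : smooth_convex f (L + c * K ^+ 2).
Proof.
split=> [|x|].
- apply: convex_functionI => x y t t01.
  have [/convex_functionP /(_ x y t t01) hc _ _] := psi_s_smooth.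
  have hA : A (t *: x + (1 - t) *: y) - b = t *: (A x - b) + (1 - t) *: (A y - b).
    rewrite linearD !linearZ /= !scalerBr addrACA -opprD -scalerDl.
    by rewrite [t + (1 - t)]addrC subrK scale1r.
  rewrite /f /smooth_auglag hA !norm2_sqr; move: (A x - b) (A y - b) => X Y.
  have := dotv_ge0 (X - Y); rewrite !dotvE [dotv Y X]dotvC => hXY.
  have : 0 <= c / 2 * (t * (1 - t)) *
      (dotv X X - dotv X Y + (- dotv X Y + dotv Y Y)).
    move/andP: t01 => [t0 t1]; apply: mulr_ge0; last by lra.
    by rewrite !mulr_ge0// subr_ge0.
  lra.
- by have [] := auglag_grad x.
- move=> [x y] _ /=.
  have [_ ->] := auglag_grad x; have [_ ->] := auglag_grad y.
  rewrite opprD addrACA -adjointB opprD addrACA subrr add0r -scalerBr.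
  have -> : A x - b - (A y - b) = A (x - y) by rewrite opprB addrA subrK linearB.
  apply: le_trans (ler_normD _ _) _; rewrite mulrDl; apply: lerD.
    exact: grad_lipschitz.
  apply: le_trans (norm_adjoint _) _; rewrite norm2Z// mulrCA -mulrA ler_wpM2l//.
  by rewrite expr2 -mulrA ler_wpM2l.
Qed.

End AugmentedLagrangian.

(** * One pass of the accumulative regularization *)

Section OnePass.
Variables (R : realType) (E : euclideanType R).
Variables (f : E -> R) (h : E -> \bar R) (L : R).
Hypothesis L_gt0 : 0 < L.
Hypothesis f_smooth : smooth_convex f L.
Hypothesis h_cvx : closed_proper_convex h.
Hypothesis h_compact : compact (dom h).
Implicit Types (x y z u g xbar xs xp xpp : E).

Let H x := fine (h x).

Lemma prox_strongly_convex sigma xbar :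
  strongly_convex sigma (fun u => f u + sigma / 2 * `|u - xbar| ^+ 2).
Proof.
have := strongly_convexD
  (strongly_convex_smooth (let: And3 c _ _ := f_smooth in c))
  (strongly_convex_sqr (sigma / 2) xbar).
by rewrite add0r (_ : 2 * (sigma / 2) = sigma) //; field.
Qed.

Lemma prox_argmin_exists sigma xbar :
  exists xs, is_argmin (prox_objective f h sigma xbar) xs.
Proof.
apply: (argmin_exists h_cvx h_compact
  (q := fun u => f u + sigma / 2 * `|u - xbar| ^+ 2)) => x.
apply: cvgD; first exact: (smooth_continuous f_smooth).
by apply: cvgM; [exact: cvg_cst|exact: sqr_dist_continuous].
Qed.

Lemma bt_p_exists x M : exists xp, bt_p f h x M xp.
Proof.
apply: (argmin_exists h_cvx h_compact
  (q := fun u => inner (grad f x) u + M * `|u - x| ^+ 2)) => y.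
apply: cvgD; first exact: inner_continuous.
by apply: cvgM; [exact: cvg_cst|exact: sqr_dist_continuous].
Qed.

Lemma bt_pp_exists sigma x xbar M : exists xpp, bt_pp f h sigma x xbar M xpp.
Proof.
apply: (argmin_exists h_cvx h_compact
  (q := fun u => inner (grad f x) u + sigma / 2 * `|u - xbar| ^+ 2
                 + M * `|u - x| ^+ 2)) => y.
apply: cvgD; last by apply: cvgM; [exact: cvg_cst|exact: sqr_dist_continuous].
apply: cvgD; first exact: inner_continuous.
by apply: cvgM; [exact: cvg_cst|exact: sqr_dist_continuous].
Qed.

Lemma bt_p_strong x M xp u : bt_p f h x M xp -> dom h u ->
  inner (grad f x) xp + M * `|xp - x| ^+ 2 + H xp + M * `|u - xp| ^+ 2 <=
  inner (grad f x) u + M * `|u - x| ^+ 2 + H u.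
Proof.
move=> /(argmin_strong h_cvx (strongly_convexD
  (strongly_convex_inner (grad f x)) (strongly_convex_sqr M x))) hs hu.
by have := hs _ hu; rewrite add0r [2 * M]mulrC mulfK.
Qed.

Lemma bt_pp_strong sigma x xbar M xpp u :
  bt_pp f h sigma x xbar M xpp -> dom h u ->
  inner (grad f x) xpp + sigma / 2 * `|xpp - xbar| ^+ 2 + M * `|xpp - x| ^+ 2
    + H xpp + (sigma / 2 + M) * `|u - xpp| ^+ 2 <=
  inner (grad f x) u + sigma / 2 * `|u - xbar| ^+ 2 + M * `|u - x| ^+ 2 + H u.
Proof.
move=> /(argmin_strong h_cvx (strongly_convexD (strongly_convexD
  (strongly_convex_inner (grad f x)) (strongly_convex_sqr (sigma / 2) xbar))
  (strongly_convex_sqr M x))) hs hu.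
have := hs _ hu; rewrite add0r -mulrDr [2 * _]mulrC mulfK//.
Qed.

(** The residual [arl_v] is a subgradient of [f + h] at the prox point: the
    excess in the strong minimality of a quadratic is exactly its linear part. *)
Lemma arl_v_subdiff x M xp : bt_p f h x M xp ->
  subdiff h xp (arl_v f x xp M - grad f xp).
Proof.
move=> hp; apply/(subdiffP h_cvx); split.
  by have /(argminP h_cvx)[] := hp.
move=> u hu; have := bt_p_strong hp hu.
rewrite /arl_v addrK !normr2E !innerE -/(H u) -/(H xp).
rewrite [inner x u]innerC [inner x xp]innerC [inner u xp]innerC; lra.
Qed.

Lemma arl_v_norm x M xpp xp : bt_test f x xpp xp M ->
  `|arl_v f x xp M| <= 3 * M * `|xp - x|.
Proof.
move=> [_ lip]; rewrite /arl_v -addrA [- _ + _]addrC; apply: le_trans (ler_normD _ _) _.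
have M0 : 0 <= M * `|xp - x| by apply: le_trans lip.
have [M1|M1] := leP 0 M.
  rewrite normrZ ger0_norm ?mulr_ge0// [`|x - xp|]distrC; lra.
have xx : `|xp - x| = 0.
  by apply/eqP; rewrite eq_le normr_ge0 andbT -(nmulr_rge0 _ M1).
by move: lip; rewrite normrZ [`|x - xp|]distrC xx !mulr0 add0r.
Qed.

Section Accuracy.
Variables (sigma M : R) (x0 xbar xs x xpp xp : E).
Hypothesis sigma_gt0 : 0 < sigma.
Hypothesis M_gt0 : 0 < M.
Hypothesis xs_min : is_argmin (prox_objective f h sigma xbar) xs.
Hypothesis x_dom : dom h x.
Hypothesis x_acc :
  (prox_objective f h sigma xbar x <= prox_objective f h sigma xbar xs
     + (sigma / 128 * `|x0 - xs| ^+ 2)%:E)%E.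

Let phi u := f u + sigma / 2 * `|u - xbar| ^+ 2 + H u.

Let phi_acc : phi x <= phi xs + sigma / 128 * `|x0 - xs| ^+ 2.
Proof.
have /(argminP h_cvx)[hs _] := xs_min; move: x_acc.
by rewrite /prox_objective (dom_fine h_cvx x_dom) (dom_fine h_cvx hs) -!EFinD lee_fin.
Qed.

Let phi_min u : dom h u -> phi xs <= phi u.
Proof. by have /(argminP h_cvx)[hs] := xs_min; apply. Qed.

(** The solver accuracy is a multiple of the squared starting distance, which
    strong convexity converts into a contraction towards [xs]. *)
Lemma solver_dist : `|x - xs| <= `|x0 - xs| / 8.
Proof.
apply: ler_of_sqr; first by rewrite divr_ge0.
have := argmin_strong h_cvx (prox_strongly_convex _ _) xs_min x_dom => hs.
rewrite -(@ler_pM2l _ (sigma / 2)) ?divr_gt0//.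
move: phi_acc hs; rewrite /phi /H /=; lra.
Qed.

Hypothesis pp_min : bt_pp f h sigma x xbar M xpp.
Hypothesis p_min : bt_p f h x M xp.
Hypothesis test : bt_test f x xpp xp M.

(** The accepted step from [x] to [xpp] decreases [phi], but [x] is nearly
    optimal for [phi]. *)
Let pp_dist : `|xpp - x| <= `|x0 - xs| / 8.
Proof.
apply: ler_of_sqr; first by rewrite divr_ge0.
rewrite -(@ler_pM2l _ (sigma / 2)) ?divr_gt0//.
have /(argminP h_cvx)[hpp _] := pp_min.
have [] := test; rewrite innerDr innerNr => desc _.
have := bt_pp_strong pp_min x_dom; rewrite subrr normr0 expr0n/= mulr0.
have := phi_min hpp; move: phi_acc; rewrite /phi [`|x - xpp|]distrC /H /=.
have M2 : 0 <= M * `|xpp - x| ^+ 2 by rewrite mulr_ge0 ?sqr_ge0// ltW.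
lra.
Qed.

(** The two subproblems differ by the term centered at [xbar]; adding their strong
    minimality inequalities leaves the variation of this term. *)
Let p_pp_dist : 2 * M * `|xp - xpp| <= sigma * `|xpp - xbar|.
Proof.
have /(argminP h_cvx)[hpp _] := pp_min.
have /(argminP h_cvx)[hp _] := p_min.
have [->|d0] := eqVneq (xp - xpp) 0.
  by rewrite normr0 mulr0 mulr_ge0// ltW.
have dgt0 : 0 < `|xp - xpp| by rewrite normr_gt0.
rewrite -(ler_pM2r dgt0).
have := bt_pp_strong pp_min hp; have := bt_p_strong p_min hpp.
rewrite [`|xpp - xp|]distrC.
have : sigma / 2 * `|xp - xbar| ^+ 2 <=
       sigma / 2 * (`|xp - xpp| + `|xpp - xbar|) ^+ 2.
  by rewrite ler_pM2l ?divr_gt0// ler_sqr ?nnegrE ?addr_ge0// ler_distD.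
lra.
Qed.

(** At termination [M <= sigma], so the residual is of order [sigma] times the
    displacement of the prox step. That step is compared with the one of the
    regularized objective, which is short since the solver was accurate. *)
Lemma arl_v_bound : M <= sigma ->
  `|arl_v f x xp M| <= 9 / 16 * sigma * `|x0 - xs| + 3 / 2 * sigma * `|x - xbar|.
Proof.
move=> Ms; apply: le_trans (arl_v_norm test) _.
have t1 : `|xp - x| <= `|xp - xpp| + `|xpp - x| by exact: ler_distD.
have t2 : `|xpp - xbar| <= `|xpp - x| + `|x - xbar| by exact: ler_distD.
have h1 : M * `|xp - x| <= M * (`|xp - xpp| + `|xpp - x|) by rewrite ler_pM2l.
have h2 : sigma * `|xpp - xbar| <= sigma * (`|xpp - x| + `|x - xbar|).
  by rewrite ler_pM2l.
have h3 : M * `|xpp - x| <= sigma * `|xpp - x| by rewrite ler_wpM2r.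
have h4 : sigma * `|xpp - x| <= sigma * (`|x0 - xs| / 8) by rewrite ler_pM2l.
have := p_pp_dist; lra.
Qed.

End Accuracy.

(** Potential of the accumulative regularization. The first term is invariant
    under the recentering of the quadratic up to the displacement of the iterate,
    and the second is halved by each solver call, which pays for that
    displacement. *)
Definition arl_potential (sigma : R) xbar x0 xs : R :=
  sigma * `|xbar - x0| + 9 / 4 * (sigma * `|x0 - xs|).

(** The recentered objective is the previous one plus a multiple of the squared
    distance to [x], up to a constant; hence its minimizer is closer to [x]. *)
Lemma prox_center_moves sigma xbar x xs xs' : 0 < sigma ->
  is_argmin (prox_objective f h sigma xbar) xs ->
  is_argmin (prox_objective f h (4 * sigma) (4^-1 *: xbar + (3 / 4) *: x)) xs' ->
  `|xs' - x| <= `|xs - x|.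
Proof.
move=> s0 /(argminP h_cvx)[hs mins] /(argminP h_cvx)[hs' mins'].
apply: ler_of_sqr => //; rewrite -(@ler_pM2l _ (sigma * (3 / 2))) ?mulr_gt0//.
have := mins _ hs'; have := mins' _ hs; rewrite !normr2E !innerE.
rewrite ![inner x xbar]innerC ![inner xs xbar]innerC ![inner xs' xbar]innerC.
by rewrite ![inner xs x]innerC ![inner xs' x]innerC; lra.
Qed.

Lemma arl_potential_next sigma xbar x0 x xs xs' : 0 < sigma ->
  is_argmin (prox_objective f h sigma xbar) xs ->
  is_argmin (prox_objective f h (4 * sigma) (4^-1 *: xbar + (3 / 4) *: x)) xs' ->
  `|x - xs| <= `|x0 - xs| / 8 ->
  arl_potential (4 * sigma) (4^-1 *: xbar + (3 / 4) *: x) x xs' <=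
  arl_potential sigma xbar x0 xs.
Proof.
move=> s0 mins mins' xxs; have := prox_center_moves s0 mins mins'.
rewrite /arl_potential => xs'x.
have -> : 4^-1 *: xbar + (3 / 4) *: x - x = 4^-1 *: (xbar - x).
  rewrite scalerBr -addrA -[X in _ + (_ - X)]scale1r -scalerBl; congr (_ + _).
  by rewrite -scaleNr; congr (_ *: _); field.
rewrite normrZ ger0_norm ?invr_ge0//.
have t1 : sigma * `|xbar - x| <= sigma * (`|xbar - x0| + (`|x0 - xs| + `|x - xs|)).
  rewrite ler_pM2l//; apply: le_trans (ler_distD x0 _ _) _; rewrite lerD2l.
  by rewrite [`|x - xs|]distrC ler_distD.
have t2 : sigma * `|x - xs'| <= sigma * (`|x0 - xs| / 8).
  by rewrite ler_pM2l// distrC (le_trans xs'x)// distrC.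
have t3 : sigma * `|x - xs| <= sigma * (`|x0 - xs| / 8) by rewrite ler_pM2l.
by lra.
Qed.

End OnePass.

(** * Termination and cost of the subroutines *)

Lemma exists_pow2_ge (R : realType) (x y : R) : 0 < y -> exists n, x <= 2 ^+ n * y.
Proof.
move=> y0; exists (Num.bound (x / y)).
by rewrite -ler_pdivrMr// ltW// upper_nthrootP.
Qed.

Lemma total_evals_add (R : realType) c1 c2 :
  (total_evals (add_evals c1 c2))%:R =
  (total_evals c1)%:R + (total_evals c2)%:R :> R.
Proof. by rewrite -natrD; congr (_%:R); rewrite /total_evals /= addnACA. Qed.

(** Apart from the increases of the estimate, a pass with regularization [sigma]
    costs at most [pass_rate * sqrt (L / sigma) + pass_overhead] evaluations, and a
    whole call started at [sigma] at most [2 * arl_rate * sqrt (L / sigma) + pass_overhead]. *)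
Definition pass_overhead (R : realType) (cres : nat) : R := cres%:R + 5.
Definition pass_rate (R : realType) (cA : R) (cres : nat) : R :=
  (1 + cres%:R) * (8 * Num.sqrt (2 * cA)).
Definition arl_rate (R : realType) (cA : R) (cres : nat) : R :=
  pass_rate cA cres + 2 * pass_overhead R cres.

Lemma pass_overhead_ge0 (R : realType) cres : 0 <= pass_overhead R cres.
Proof. by rewrite addr_ge0. Qed.

Lemma pass_rate_ge0 (R : realType) (cA : R) cres : 0 <= pass_rate cA cres.
Proof. by rewrite !mulr_ge0 ?addr_ge0. Qed.

Lemma arl_rate_ge0 (R : realType) (cA : R) cres : 0 <= arl_rate cA cres.
Proof. by rewrite addr_ge0 ?pass_rate_ge0// mulr_ge0 ?pass_overhead_ge0. Qed.

Section Subroutines.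
Variables (R : realType) (E : euclideanType R).
Variables (f : E -> R) (h : E -> \bar R) (L : R).
Variables (S : solver E) (cA : R) (cres : nat).
Hypothesis L_gt0 : 0 < L.
Hypothesis f_smooth : smooth_convex f L.
Hypothesis h_cvx : closed_proper_convex h.
Hypothesis h_compact : compact (dom h).
Hypothesis cA_gt0 : 0 < cA.
Hypothesis S_spec : solver_spec cA cres S.
Implicit Types (x y z u g v w xbar xs xp xpp : E) (sigma M : R).

Section SolverCall.
Variables (sigma : R) (xbar x0 : E).
Hypothesis sigma_gt0 : 0 < sigma.
Hypothesis xbar_dom : dom h xbar.
Hypothesis x0_dom : dom h x0.

Let spec := S_spec L_gt0 f_smooth h_cvx h_compact sigma_gt0 xbar_dom x0_dom.

Lemma solver_test_late k : (0 < k)%N ->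
  8 * Num.sqrt (2 * cA) * Num.sqrt (L / sigma) <= k%:R ->
  solver_test S f h sigma xbar x0 k.
Proof.
move=> k0 kge; have [_ est _ _] := spec k0; apply: le_trans kge.
rewrite -[leRHS]mulrA.
rewrite ler_pM2l// -sqrtrM; last by rewrite mulr_ge0// ltW.
rewrite ler_sqrt; last first.
  by rewrite mulr_ge0 ?divr_ge0 ?mulr_ge0// ltW.
by rewrite mulrA ler_pM2r ?invr_gt0// -mulrA ler_pM2l.
Qed.

Lemma solver_stops_exists : exists k, solver_stops_at S f h sigma xbar x0 k.
Proof.
have ex : exists k, (0 < k)%N &&
    (8 * Num.sqrt (2 * solver_est (S f h sigma xbar x0 k) / sigma) <= k%:R).
  set t : R := 8 * Num.sqrt (2 * cA) * Num.sqrt (L / sigma).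
  exists (Num.truncn t).+1; apply: solver_test_late => //.
  exact/ltW/truncnS_gt.
case: (ex_minnP ex) => k /andP[k0 tk] min_k; exists k; split=> // j /andP[j0 jk] tj.
have := min_k j; rewrite j0 => /(_ tj).
by rewrite leqNgt jk.
Qed.

Variable k : nat.
Hypothesis stops : solver_stops_at S f h sigma xbar x0 k.

(** The iteration before the last one failed the test. *)
Lemma solver_stops_le :
  k%:R <= 1 + 8 * Num.sqrt (2 * cA) * Num.sqrt (L / sigma).
Proof.
have [k0 _ min_k] := stops; case: k k0 min_k => // -[|j] _ min_k.
  by rewrite lerDl !mulr_ge0.
rewrite -[j.+2%:R]natr1 addrC lerD2l leNgt; apply/negP => /ltW late.
by apply: (min_k j.+1); [rewrite /= ltnSn|exact: solver_test_late].
Qed.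

Let x := solver_pt (S f h sigma xbar x0 k).

Lemma solver_dom : dom h x.
Proof. by have [k0 _ _] := stops; have [] := spec k0. Qed.

Lemma solver_accuracy xs : is_argmin (prox_objective f h sigma xbar) xs ->
  (prox_objective f h sigma xbar x <= prox_objective f h sigma xbar xs
     + (sigma / 128 * `|x0 - xs| ^+ 2)%:E)%E.
Proof.
move=> xs_min; have [k0 tk _] := stops; have [_ _ /(_ xs xs_min) acc _] := spec k0.
apply: le_trans acc _; apply: leeD => //; rewrite lee_fin ler_wpM2r ?sqr_ge0//.
move: tk; rewrite /solver_test; set est := solver_est _ => tk.
have k0' : 0 < k%:R ^+ 2 :> R by rewrite exprn_gt0// ltr0n.
rewrite ler_pdivrMr//; have [e0|/ltW e0] := leP est 0.
  by apply: (le_trans e0); rewrite mulr_ge0 ?sqr_ge0 ?divr_ge0// ltW.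
have : (8 * Num.sqrt (2 * est / sigma)) ^+ 2 <= k%:R ^+ 2.
  by rewrite ler_sqr ?nnegrE ?mulr_ge0.
rewrite exprMn sqr_sqrtr; last by rewrite divr_ge0 ?mulr_ge0// ltW.
rewrite -(ler_pM2l sigma_gt0) => le1.
have : sigma * (8 ^+ 2 * (2 * est / sigma)) = 128 * est.
  by field; rewrite gt_eqF.
lra.
Qed.

End SolverCall.

Variable Mmin : R.
Hypothesis Mmin_gt0 : 0 < Mmin.

Lemma backtracking_exists sigma x xbar M : 0 < M ->
  exists xpp xp M' n, backtracking f h sigma x xbar M xpp xp M' n.
Proof.
move=> M0; have [j] := exists_pow2_ge (2 * L) M0; elim: j M M0 => [|j IH] M M0 LM.
  have [xpp hpp] := bt_pp_exists f h_cvx h_compact sigma x xbar M.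
  have [xp hp] := bt_p_exists f h_cvx h_compact x M.
  rewrite expr0 mul1r in LM; exists xpp, xp, M, 1%N; apply: bt_accept => //.
  by apply: (backtracking_accepts f_smooth) => //; exact: ltW.
have [xpp hpp] := bt_pp_exists f h_cvx h_compact sigma x xbar M.
have [xp hp] := bt_p_exists f h_cvx h_compact x M.
have [t|nt] := pselect (bt_test f x xpp xp M).
  by exists xpp, xp, M, 1%N; exact: bt_accept.
have [||ypp [yp [M' [n bt]]]] := IH (2 * M); first by rewrite mulr_gt0.
  by rewrite mulrA -exprSr.
by exists ypp, yp, M', n.+1; exact: bt_double bt.
Qed.

(** A trial with an estimate above [2 * L] is accepted, which bounds the estimates
    by [4 * L]. Each rejected trial raises the estimate by at least [Mmin], so the
    number of trials telescopes over successive calls. *)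
Lemma backtracking_spec sigma x xbar M xpp xp M' n :
  backtracking f h sigma x xbar M xpp xp M' n -> Mmin <= M <= 4 * L ->
  [/\ bt_pp f h sigma x xbar M' xpp, bt_p f h x M' xp, bt_test f x xpp xp M',
      M <= M' <= 4 * L & n%:R <= 1 + (M' - M) / Mmin].
Proof.
elim=> {M xpp xp M' n} [M xpp xp hpp hp test /andP[M1 M2]|].
  by split; rewrite ?lexx// subrr mul0r addr0.
move=> M ypp yp xpp xp M' n _ _ nt _ IH /andP[M1 M2].
have ML : M < 2 * L.
  rewrite ltNge; apply/negP => LM; apply: nt.
  by apply: (backtracking_accepts f_smooth) => //; exact: le_trans (ltW _) M1.
have M0 : 0 < M by apply: lt_le_trans M1.
have [|hpp hp test /andP[M3 M4] nle] := IH; first by apply/andP; split; lra.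
split=> //; first by rewrite M4 andbT; lra.
rewrite -natr1; have : 1 <= M / Mmin by rewrite ler_pdivlMr// mul1r.
lra.
Qed.

Local Notation c0 := (pass_overhead R cres).
Local Notation kappa0 := (pass_rate cA cres).
Local Notation kappa := (arl_rate cA cres).

Lemma arl_step_exists sigma xbar x0 M0 : 0 < sigma -> dom h xbar -> dom h x0 ->
  0 < M0 -> exists x xp v M cost, arl_step S f h sigma xbar x0 M0 x xp v M cost.
Proof.
move=> s0 hxbar hx0 M00; have [k stops] := solver_stops_exists s0 hxbar hx0.
have [xpp [xp [M [n bt]]]] := backtracking_exists sigma
  (solver_pt (S f h sigma xbar x0 k)) xbar M00.
by do 5 eexists; exists k, n, xpp; split; eauto.
Qed.

Lemma arl_step_spec sigma xbar x0 M0 x xp v M cost :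
  arl_step S f h sigma xbar x0 M0 x xp v M cost ->
  0 < sigma -> dom h xbar -> dom h x0 -> Mmin <= M0 <= 4 * L ->
  [/\ dom h x, dom h xp /\ subdiff h xp (v - grad f xp), M0 <= M <= 4 * L,
      forall xs, is_argmin (prox_objective f h sigma xbar) xs ->
        `|x - xs| <= `|x0 - xs| / 8 /\
        (M <= sigma -> `|v| <= 3 / 2 * arl_potential sigma xbar x0 xs)
    & (total_evals cost)%:R <=
        kappa0 * Num.sqrt (L / sigma) + c0 + 3 * ((M - M0) / Mmin)].
Proof.
move=> [k [n [xpp [stops -> bt -> ->]]]] s0 hxbar hx0 hM.
have hx := solver_dom s0 hxbar hx0 stops.
have [hpp hp test hM' nle] := backtracking_spec bt hM.
move/andP: (hM) => [M1 M2]; move/andP: (hM') => [M3 M4].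
have Mgt0 : 0 < M by apply: lt_le_trans M3; apply: lt_le_trans M1.
split=> //.
- split; last exact: arl_v_subdiff hp.
  by have /(argminP h_cvx)[] := hp.
- move=> xs mins; have acc := solver_accuracy s0 hxbar hx0 stops mins.
  have xxs := solver_dist f_smooth h_cvx s0 mins hx acc; split=> // Ms.
  have := arl_v_bound h_cvx s0 Mgt0 mins hx acc hpp hp test Ms.
  move=> /le_trans; apply; rewrite /arl_potential.
  move: xxs; set x' := solver_pt _ => xxs.
  have : sigma * `|x' - xbar| <= sigma * (`|x' - xs| + (`|x0 - xs| + `|xbar - x0|)).
    rewrite ler_pM2l//; apply: le_trans (ler_distD xs _ _) _; rewrite lerD2l.
    by rewrite [`|x0 - _|]distrC [`|xbar - _|]distrC ler_distD.
  have : sigma * `|x' - xs| <= sigma * (`|x0 - xs| / 8) by rewrite ler_pM2l.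
  have : 0 <= sigma * `|x0 - xs| by rewrite mulr_ge0// ltW.
  lra.
- have [k0 _ _] := stops.
  have [_ _ _ res] := S_spec L_gt0 f_smooth h_cvx h_compact s0 hxbar hx0 k0.
  have kle := solver_stops_le s0 hxbar hx0 stops.
  have res' : (solver_res (S f h sigma xbar x0 k))%:R <= cres%:R * k%:R :> R.
    by rewrite -natrM ler_nat.
  rewrite /total_evals /= mul2n -addnn !natrD -natr1.
  have : (1 + cres%:R) * k%:R <=
      (1 + cres%:R) * (1 + 8 * Num.sqrt (2 * cA) * Num.sqrt (L / sigma)).
    by rewrite ler_wpM2l// addr_ge0.
  rewrite /pass_rate /pass_overhead; lra.
Qed.

Lemma recentering sigma xbar x : 0 < sigma ->
  (1 - (1 - sigma / (4 * sigma))) *: xbar + (1 - sigma / (4 * sigma)) *: x =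
  4^-1 *: xbar + (3 / 4) *: x.
Proof.
by move=> s0; congr (_ *: _ + _ *: _); field; rewrite ?gt_eqF.
Qed.

Lemma recentering_dom xbar x : dom h xbar -> dom h x ->
  dom h (4^-1 *: xbar + (3 / 4) *: x).
Proof.
move=> hxbar hx; have -> : 3 / 4 = 1 - 4^-1 :> R by field.
by apply: (dom_convex h_cvx hxbar hx _).1; apply/andP; split; lra.
Qed.

Lemma arl_loop_exists sigma xbar x0 M0 : 0 < sigma -> dom h xbar -> dom h x0 ->
  Mmin <= M0 <= 4 * L ->
  exists xp v M cost, arl_loop S f h sigma xbar x0 M0 xp v M cost.
Proof.
move=> s0; have [j] := exists_pow2_ge (4 * L) s0.
elim: j sigma xbar x0 M0 s0 => [|j IH] sigma xbar x0 M0 s0 Ls hxbar hx0 hM;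
  have M00 : 0 < M0 by case/andP: hM => M1 _; apply: lt_le_trans M1.
- have [x [xp [v [M [cost step]]]]] := arl_step_exists s0 hxbar hx0 M00.
  have [_ _ /andP[_ ML] _ _] := arl_step_spec step s0 hxbar hx0 hM.
  exists xp, v, M, cost; apply: arl_stop step _.
  by apply: le_trans ML _; rewrite expr0 mul1r in Ls.
- have [x [xp [v [M [cost step]]]]] := arl_step_exists s0 hxbar hx0 M00.
  have [hx _ /andP[M1 ML] _ _] := arl_step_spec step s0 hxbar hx0 hM.
  have [Ms|/negP Ms] := boolP (M <= sigma).
    by exists xp, v, M, cost; exact: arl_stop step _.
  have [|||||yp [w [M' [cost' run]]]] :=
    IH (4 * sigma) (4^-1 *: xbar + (3 / 4) *: x) x M.
  + by rewrite mulr_gt0.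
  + rewrite (le_trans Ls)// exprSr -mulrA ler_pM2l ?exprn_gt0//; lra.
  + exact: recentering_dom.
  + by [].
  + by rewrite ML andbT; case/andP: hM => M2 _; exact: le_trans M1.
  + exists yp, w, M', (add_evals cost cost'); apply: arl_next step Ms _ => /=.
    by rewrite recentering.
Qed.

(** The solver costs form a geometric series in [sigma], because [sigma]
    quadruples at each pass. The constant costs of a pass that is not the last are
    absorbed in it: such a pass has [sigma < M <= 4 * L], hence
    [1 <= 2 * sqrt (L / sigma)]. *)
Lemma arl_loop_spec sigma xbar x0 M0 xp v M cost :
  arl_loop S f h sigma xbar x0 M0 xp v M cost -> forall W : R,
  0 < sigma -> dom h xbar -> dom h x0 -> Mmin <= M0 <= 4 * L ->
  (forall xs, is_argmin (prox_objective f h sigma xbar) xs ->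
     arl_potential sigma xbar x0 xs <= W) ->
  [/\ dom h xp /\ subdiff h xp (v - grad f xp), `|v| <= 3 / 2 * W,
      M0 <= M <= 4 * L
    & (total_evals cost)%:R <=
        2 * kappa * Num.sqrt (L / sigma) + c0 + 3 * ((M - M0) / Mmin)].
Proof.
have c0_ge0 : 0 <= c0 := pass_overhead_ge0 R cres.
have kappa0_ge0 : 0 <= kappa0 := pass_rate_ge0 cA cres.
elim=> {sigma xbar x0 M0 xp v M cost}.
  move=> sigma xbar x0 M0 x xp v M cost step Ms W s0 hxbar hx0 hM pot.
  have [hx hxp hM' hxs hcost] := arl_step_spec step s0 hxbar hx0 hM.
  have [xs mins] := prox_argmin_exists f_smooth h_cvx h_compact sigma xbar.
  split=> //.
    have [_ /(_ Ms) /le_trans] := hxs _ mins; apply.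
    by rewrite ler_pM2l// pot.
  apply: le_trans hcost _; rewrite !lerD2r ler_wpM2r//.
  by rewrite /arl_rate; lra.
move=> sigma xbar x0 M0 x xp v M cost yp w M' cost' step Ms /= _.
move=> IH W s0 hxbar hx0 hM pot.
have [hx hxp /andP[M1 M2] hxs hcost] := arl_step_spec step s0 hxbar hx0 hM.
have [xs mins] := prox_argmin_exists f_smooth h_cvx h_compact sigma xbar.
rewrite recentering// in IH.
have hM1 : Mmin <= M <= 4 * L.
  by rewrite M2 andbT; case/andP: hM => M3 _; exact: le_trans M1.
have [|||hyp hw /andP[M3 M4] hcost'] := IH W _ _ hx hM1.
- by rewrite mulr_gt0.
- exact: recentering_dom.
- move=> xs' mins'; apply: le_trans (pot _ mins).
  have [xxs _] := hxs _ mins.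
  exact: (arl_potential_next h_cvx s0 mins mins' xxs).
split=> //; first by rewrite M4 andbT (le_trans M1).
rewrite total_evals_add.
have q4 : Num.sqrt (L / (4 * sigma)) = Num.sqrt (L / sigma) / 2.
  rewrite invfM mulrA mulrAC sqrtrM ?divr_ge0 ?ltW// sqrtrV//.
  by rewrite (_ : 4 = 2 ^+ 2 :> R) ?sqrtr_sqr ?ger0_norm//; ring.
have q1 : 1 <= 2 * Num.sqrt (L / sigma).
  rewrite -ler_pdivrMl// mulr1.
  rewrite -[2^-1]ger0_norm ?invr_ge0// -sqrtr_sqr ler_wsqrtr//.
  rewrite ler_pdivlMr//; move/negP: Ms; rewrite -ltNge => Ms.
  by rewrite exprVn ler_pdivrMl// -natrX; lra.
have := ler_wpM2l c0_ge0 q1.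
rewrite q4 in hcost'; move: hcost hcost'; rewrite /arl_rate; lra.
Qed.

Local Notation D := (diameter (dom h)).

Section PFAR.
Variable eps : R.
Hypothesis eps_gt0 : 0 < eps.

(** Accumulative regularization started with [sigma = eps / (7 * D')] returns a
    residual below [eps * D / D'], so the guess [D'] is quadrupled only as long
    as it is below the diameter. *)
Lemma arl_spec x0 D0 M0 xp v M cost : 0 < D0 -> dom h x0 ->
  Mmin <= M0 <= 4 * L -> arl S f h x0 (eps / (7 * (4 * D0))) M0 xp v M cost ->
  [/\ dom h xp /\ subdiff h xp (v - grad f xp),
      ~ (`|v| <= eps) -> 4 * D0 <= D, M0 <= M <= 4 * L
    & (total_evals cost)%:R <=
        2 * kappa * Num.sqrt (28 * D0 * L / eps) + c0 + 3 * ((M - M0) / Mmin)].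
Proof.
move=> D00 hx0 hM run; have s0 : 0 < eps / (7 * (4 * D0)).
  by rewrite divr_gt0// !mulr_gt0.
have [|hxp vle hM' cle] :=
  arl_loop_spec (W := 9 / 4 * (eps / (7 * (4 * D0)) * D)) run s0 hx0 hx0 hM.
  move=> xs mins; rewrite /arl_potential subrr normr0 mulr0 add0r ler_pM2l//.
  rewrite ler_pM2l//; apply: dom_bounded => //.
  by have /(argminP h_cvx)[] := mins.
split=> //.
  move=> /negP; rewrite -ltNge => epsv; have := lt_le_trans epsv vle.
  have -> : 3 / 2 * (9 / 4 * (eps / (7 * (4 * D0)) * D)) =
            eps * (27 / 224 * D / D0) by field; rewrite gt_eqF.
  rewrite -[ltLHS]mulr1 ltr_pM2l// ltr_pdivlMr// mul1r; lra.
apply: le_trans cle _; rewrite (_ : L / _ = 28 * D0 * L / eps)//.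
by field; rewrite !gt_eqF.
Qed.

Lemma pfar_exists x0 M0 D0 : 0 < D0 -> dom h x0 -> Mmin <= M0 <= 4 * L ->
  exists x v cost, pfar S f h x0 M0 D0 eps x v cost.
Proof.
move=> D00; have [j] := exists_pow2_ge (D + 1) (mulr_gt0 (ltr0n R 4) D00).
elim: j x0 M0 D0 D00 => [|j IH] x0 M0 D0 D00 DD hx0 hM;
  have s0 : 0 < eps / (7 * (4 * D0)) by rewrite divr_gt0// !mulr_gt0.
- have [x [v [M [cost run]]]] := arl_loop_exists s0 hx0 hx0 hM.
  have [_ le _ _] := arl_spec D00 hx0 hM run.
  exists x, v, cost; apply: pfar_stop run _.
  by apply: contrapT => /le; rewrite expr0 mul1r in DD; lra.
- have [x [v [M [cost run]]]] := arl_loop_exists s0 hx0 hx0 hM.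
  have [[hx _] _ /andP[M1 M2] _] := arl_spec D00 hx0 hM run.
  have [ve|/negP ve] := boolP (`|v| <= eps).
    by exists x, v, cost; exact: pfar_stop run ve.
  have [|||y [w [cost' run']]] := IH x M (4 * D0) _ _ hx.
  + by rewrite mulr_gt0.
  + by rewrite (le_trans DD)// exprSr -mulrA ler_pM2l ?exprn_gt0//; lra.
  + by rewrite M2 andbT; case/andP: hM => M3 _; exact: le_trans M1.
  + by exists y, w, (add_evals cost cost'); exact: pfar_next run ve run'.
Qed.

Lemma pfar_spec x0 M0 D0 x v cost : pfar S f h x0 M0 D0 eps x v cost ->
  forall N : nat, 0 < D0 <= D -> D < 2 ^+ N * (4 * D0) -> dom h x0 ->
  Mmin <= M0 <= 4 * L ->
  [/\ dom h x, subdiff h x (v - grad f x), `|v| <= eps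
    & (total_evals cost)%:R <=
        N.+1%:R * (2 * kappa * Num.sqrt (28 * D * L / eps) + c0)
        + 3 * ((4 * L - M0) / Mmin)].
Proof.
have c0_ge0 : 0 <= c0 := pass_overhead_ge0 R cres.
have kappa_ge0 : 0 <= kappa := arl_rate_ge0 cA cres.
have mono M M' : M <= M' -> M / Mmin <= M' / Mmin by rewrite ler_pM2r ?invr_gt0.
have callcost D1 : D1 <= D -> 2 * kappa * Num.sqrt (28 * D1 * L / eps) + c0 <=
    2 * kappa * Num.sqrt (28 * D * L / eps) + c0.
  move=> D1D; rewrite lerD2r ler_wpM2l ?mulr_ge0//.
  rewrite ler_wsqrtr// ler_pM2r ?invr_gt0// ler_pM2r// ler_pM2l//.
elim=> {x0 M0 D0 x v cost}.
  move=> x0 M0 D0 x v M cost run ve N /andP[D00 D0D] DN hx0 hM.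
  have [[hx hv] _ /andP[M1 M2] hcost] := arl_spec D00 hx0 hM run.
  split=> //; apply: le_trans hcost _; apply: lerD.
    apply: le_trans (callcost _ D0D) _; rewrite ler_peMl ?ler1n//.
    by rewrite addr_ge0 ?mulr_ge0.
  by rewrite ler_pM2l// mono// lerD2r.
move=> x0 M0 D0 x v M cost y w cost' run ve _ IH N /andP[D00 D0D] DN hx0 hM.
have [[hx hv] /(_ ve) D4 /andP[M1 M2] hcost] := arl_spec D00 hx0 hM run.
case: N DN => [|N] DN; first by rewrite expr0 mul1r in DN; lra.
have [|||hy hw we hcost'] := IH N _ _ hx.
- by rewrite mulr_gt0.
- by rewrite (lt_le_trans DN)// exprSr -mulrA ler_pM2l ?exprn_gt0//; lra.
- by rewrite M2 andbT; case/andP: hM => M3 _; exact: le_trans M1.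
split=> //; rewrite total_evals_add -[N.+2%:R]natr1 mulrDl mul1r.
move: hcost hcost' (callcost _ D0D); rewrite !mulrBl; lra.
Qed.

End PFAR.
End Subroutines.

(** * The inexact augmented Lagrangian cycles *)

Lemma norm2_step (R : realType) (m : nat) (p' ps X : 'cV[R]_m) (c e : R) :
  c * dotv (p' - ps) X <= e / 2 ->
  norm2 (p' - ps) ^+ 2 + (c * norm2 X) ^+ 2 <=
  norm2 (p' - c *: X - ps) ^+ 2 + e.
Proof.
rewrite exprMn !norm2_sqr [p' - _ - _]addrAC; move: (p' - ps) => q.
by rewrite !dotvE [dotv X q]dotvC; lra.
Qed.

Lemma le_predR_of_ceil_lt (R : realType) (x : R) (k : nat) :
  (Num.ceil x < k%:Z)%R -> x <= k%:R - 1.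
Proof.
rewrite -lezD1 -lerBrDr ceil_le_int => /le_trans; apply.
by rewrite rmorphB.
Qed.

Lemma iterations_new_cycle n U k : (0 < k <= U)%N ->
  (n * U + (U.+1 - 1) < n.+1 * U + (U.+1 - k))%N.
Proof. by rewrite mulSn; lia. Qed.

Lemma iterations_next n U k : (0 < k <= U)%N ->
  (n * U + (U.+1 - k.+1) < n * U + (U.+1 - k))%N.
Proof. by lia. Qed.

Lemma distance_exhausted (R : realType) (P I k t q : R) : 0 <= q -> 0 <= k ->
  P + 1 <= I -> 2 * I <= k -> t <= 1 / 2 -> q + k * (1 - t) <= P -> False.
Proof.
move=> q0 k0 PI Ik t2 H; have : k * (1 / 2) <= k * (1 - t) by rewrite ler_wpM2l//; lra.
lra.
Qed.

Lemma distance_step (R : realType) (P k t q q' s : R) : 1 <= s ->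
  q' + s <= q + t -> q + (k - 1) * (1 - t) <= P -> q' + (k + 1 - 1) * (1 - t) <= P.
Proof. lra. Qed.

Section Cycles.
Variables (R : realType) (E : euclideanType R) (m : nat) (S : solver E).
Variables (A : {linear E -> 'cV[R]_m}) (b : 'cV[R]_m).
Variables (psi_s : E -> R) (psi_n : E -> \bar R).
Variables (cA : R) (cres : nat) (Lbar K : R).
Hypothesis Lbar_gt0 : 0 < Lbar.
Hypothesis psi_s_smooth : smooth_convex psi_s Lbar.
Hypothesis psi_n_cvx : closed_proper_convex psi_n.
Hypothesis psi_n_compact : compact (dom psi_n).
Hypothesis cA_gt0 : 0 < cA.
Hypothesis S_spec : solver_spec cA cres S.
Hypothesis K_gt0 : 0 < K.
Hypothesis AK : forall v, norm2 (A v) <= K * `|v|.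
Variables (zs : E) (ps : 'cV[R]_m).
Hypothesis kkt : kkt_set A psi_s psi_n zs ps 0.
Hypothesis zs_feasible : A zs = b.
Variables (p0 : 'cV[R]_m) (eps rho M0 D0 : R).
Hypothesis eps_gt0 : 0 < eps.
Hypothesis rho_gt0 : 0 < rho.
Hypothesis M0_gt0 : 0 < M0.
Hypothesis M0_le : M0 <= 2 * Lbar.
Local Notation D := (diameter (dom psi_n)).
Hypothesis D0_itv : 0 < D0 <= D.

Local Notation c := (eps^-1).
Local Notation L := (Lbar + c * K ^+ 2).
Local Notation auglag p := (smooth_auglag A b psi_s c p).
Local Notation opf_pfar := (opf_pfar S A b psi_s psi_n eps rho c M0 D0).
Local Notation opf_loop := (opf_loop S A b psi_s psi_n p0 eps rho c M0 D0).
Local Notation new_multiplier := (new_multiplier A b c).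

Let L_gt0 : 0 < L.
Proof. by rewrite ltr_pwDl// mulr_ge0 ?sqr_ge0// invr_ge0 ltW. Qed.

Let c_ge0 : 0 <= c. Proof. by rewrite invr_ge0 ltW. Qed.

Let D_gt0 : 0 < D. Proof. by case/andP: D0_itv; exact: lt_le_trans. Qed.

Let f_smooth p : smooth_convex (auglag p) L.
Proof. exact: (auglag_smooth b p psi_s_smooth (ltW K_gt0) AK c_ge0). Qed.

Let M0_itv : M0 <= M0 <= 4 * L.
Proof.
rewrite lexx /=; apply: le_trans M0_le _.
have : 0 <= c * K ^+ 2 by rewrite mulr_ge0 ?sqr_ge0.
by have := Lbar_gt0; lra.
Qed.

Let tol_gt0 D' : 0 < D' -> 0 < Num.min (eps / (4 * D')) rho.
Proof. by move=> D'0; rewrite lt_min rho_gt0 divr_gt0// mulr_gt0. Qed.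

Lemma opf_pfar_exists D' z p : 0 < D' -> dom psi_n z ->
  exists z' r cost, opf_pfar D' z p z' r cost.
Proof.
move=> D'0 hz; case/andP: D0_itv => D00 _.
exact: (pfar_exists L_gt0 (f_smooth p) psi_n_cvx psi_n_compact cA_gt0 S_spec
  M0_gt0 (tol_gt0 D'0) D00 hz M0_itv).
Qed.

Variables (N : nat) (Dmax : R).
Hypothesis N_large : D < 2 ^+ N * (4 * D0).

(** Bound on the cost of one call of the subroutine, uniform over the cycles in which the
    guess of the diameter is at most [Dmax]. *)
Definition call_cost : R :=
  N.+1%:R * (2 * arl_rate cA cres *
             Num.sqrt (28 * D * L * (4 * Dmax / eps + rho^-1))
             + pass_overhead R cres) + 12 * L / M0.

Lemma opf_pfar_spec D' z p z' r cost : opf_pfar D' z p z' r cost ->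
  0 < D' <= Dmax -> dom psi_n z ->
  [/\ dom psi_n z', kkt_set A psi_s psi_n z' (new_multiplier p z') r,
      `|r| <= eps / (4 * D'), `|r| <= rho
    & (total_evals cost)%:R <= call_cost].
Proof.
move=> run /andP[D'0 D'max] hz.
have [hz' hr] := pfar_spec L_gt0 (f_smooth p) psi_n_cvx psi_n_compact cA_gt0
  S_spec M0_gt0 (tol_gt0 D'0) run D0_itv N_large hz M0_itv.
rewrite le_min => /andP[r1 r2] hcost; split=> //.
  exists (r - grad (auglag p) z') => //.
  have [_ ->] := auglag_grad b p psi_s_smooth (ltW K_gt0) AK c_ge0 z'.
  by rewrite /new_multiplier addrAC addrC subrK.
apply: le_trans hcost _; apply: lerD.
  rewrite ler_pM2l ?ltr0n// lerD2r ler_wpM2l//.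
    by rewrite mulr_ge0 ?arl_rate_ge0.
  rewrite ler_wsqrtr//; set t := Num.min _ _.
  rewrite ler_wpM2l//; first by rewrite mulr_ge0 ?mulr_ge0// ltW.
  have le1 : 4 * D' / eps <= 4 * Dmax / eps by rewrite ler_pM2r ?invr_gt0// ler_pM2l.
  have le2 : 0 <= rho^-1 by rewrite invr_ge0 ltW.
  have le3 : 0 <= 4 * D' / eps by rewrite divr_ge0 ?mulr_ge0// ltW.
  rewrite /t minEle; case: ifP => _; last by lra.
  by rewrite invf_div; lra.
by rewrite mulrBl divff ?gt_eqF//; lra.
Qed.

(** One multiplier step is a proximal point step on the dual. By monotonicity of
    the saddle operator at [(zs, ps)] its inexactness enters through
    [inner r (z' - zs)] only; the tolerance of [r] and the penalty [eps^-1] leave an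
    error [D / (2 * D')], free of [eps]. *)
Lemma multiplier_step D' z' p r : 0 < D' -> dom psi_n z' ->
  kkt_set A psi_s psi_n z' (new_multiplier p z') r -> `|r| <= eps / (4 * D') ->
  norm2 (new_multiplier p z' - ps) ^+ 2 + (c * norm2 (A z' - b)) ^+ 2 <=
  norm2 (p - ps) ^+ 2 + D / (2 * D').
Proof.
move=> D'0 hz' [g hg rE] rle; have [gs hgs gsE] := kkt.
set p' := new_multiplier p z' in rE *.
have p'E : p = p' - c *: (A z' - b) by rewrite /p' /new_multiplier addrK.
clearbody p'.
have [hzs _] := (subdiffP psi_n_cvx _ _).1 hgs.
have mono : dotv (p' - ps) (A z' - b) <= inner r (z' - zs).
  have -> : A z' - b = A (z' - zs) by rewrite linearB zs_feasible.
  rewrite -adjointE adjointB -[r]subr0 -rE -gsE.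
  rewrite opprD addrACA [in leRHS]innerDl lerDr opprD addrACA innerDl.
  by rewrite addr_ge0 ?(grad_monotone psi_s_smooth)//; exact: subdiff_monotone hg hgs.
have le1 : dotv (p' - ps) (A z' - b) <= eps / (4 * D') * D.
  apply: le_trans mono _; apply: le_trans (cauchy_schwarz _ _) _.
  by apply: ler_pM => //; exact: dom_bounded.
have le2 : c * dotv (p' - ps) (A z' - b) <= D / (4 * D').
  rewrite -ler_pdivlMl ?invr_gt0// invrK.
  rewrite (_ : eps * _ = eps / (4 * D') * D)//; field.
  by rewrite gt_eqF.
rewrite p'E; apply: norm2_step; apply: le_trans le2 _.
by rewrite (_ : D / (2 * D') / 2 = D / (4 * D'))//; field; rewrite gt_eqF.
Qed.

Variables (Imax : R) (U : nat).
Hypothesis Dmax_ge : D <= Dmax.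
Hypothesis Imax_ge : norm2 (p0 - ps) ^+ 2 + 1 <= Imax.
Hypothesis U_ge : (Num.ceil (2 * Imax) < U%:Z)%R.

(** State at iteration [k] of a cycle after which at most [n] more cycles can
    start: [Dmax] and [Imax] are the guesses of the last one. The squared distance
    to [ps] drops by at least [1] at each iteration without termination, up to the
    error caused by a small guess [D']. *)
Definition cycle_invariant (n : nat) (D' I' : R) (k : nat) (z : E) (p : 'cV[R]_m) :=
  [/\ 0 < D' /\ 2 ^+ n * D' = Dmax, 0 < I' /\ 2 ^+ n * I' = Imax,
      dom psi_n z, (0 < k <= U)%N
    & norm2 (p - ps) ^+ 2 + (k%:R - 1) * (1 - D / (2 * D')) <=
      norm2 (p0 - ps) ^+ 2].

Let cycle_D n D' : 0 < D' -> 2 ^+ n * D' = Dmax -> 0 < D' <= Dmax.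
Proof.
by move=> D'0 <-; rewrite D'0 /= ler_peMl ?exprn_ege1 ?ler1n// ltW.
Qed.

Lemma cycle_invariant_start n D' I' z : 0 < D' -> 2 ^+ n * D' = Dmax ->
  0 < I' -> 2 ^+ n * I' = Imax -> dom psi_n z ->
  cycle_invariant n D' I' 1 z p0.
Proof.
move=> D'0 D'E I'0 I'E hz; split=> //; last by rewrite subrr mul0r addr0.
rewrite andTb; suff : 0%:Z < U%:Z by rewrite ltz_nat.
apply: le_lt_trans U_ge; rewrite ceil_ge0; apply: lt_le_trans (ltrN10 R) _.
by rewrite mulr_ge0// -I'E mulr_ge0 ?exprn_ge0// ltW.
Qed.

(** The last cycle cannot exhaust its iterations: with its guesses they would make
    the squared distance to [ps] negative. *)
Lemma cycle_invariant_new n D' I' k z p z' : cycle_invariant n D' I' k z p ->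
  dom psi_n z' -> cycle_over I' k ->
  exists2 n', n = n'.+1 & cycle_invariant n' (2 * D') (2 * I') 1 z' p0.
Proof.
move=> [[D'0 D'E] [I'0 I'E] hz kU pk] hz' over.
case: n D'E I'E => [|n] D'E I'E; last first.
  exists n => //; apply: cycle_invariant_start; rewrite ?mulr_gt0//.
    by rewrite mulrA -exprSr.
  by rewrite mulrA -exprSr.
exfalso; rewrite expr0 mul1r in D'E; rewrite expr0 mul1r in I'E; subst D' I'.
have k1 := le_predR_of_ceil_lt over.
have k0 : 0 <= k%:R - 1 :> R by apply: le_trans k1; rewrite mulr_ge0// ltW.
apply: (distance_exhausted (sqr_ge0 (norm2 (p - ps))) k0 Imax_ge k1 _ pk).
by rewrite invfM mulrCA mulrC ler_pM2r ?invr_gt0// ler_pdivrMr// mul1r.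
Qed.

Lemma cycle_invariant_next n D' I' k z p z' r : cycle_invariant n D' I' k z p ->
  dom psi_n z' -> kkt_set A psi_s psi_n z' (new_multiplier p z') r ->
  `|r| <= eps / (4 * D') -> ~ cycle_over I' k -> ~ (norm2 (A z' - b) <= eps) ->
  cycle_invariant n D' I' k.+1 z' (new_multiplier p z').
Proof.
move=> [[D'0 D'E] [I'0 I'E] hz kU pk] hz' hr rle nover infeas; split=> //.
  have : I' <= Imax by rewrite -I'E ler_peMl ?exprn_ege1 ?ler1n// ltW.
  rewrite -(ler_pM2l (ltr0n R 2)) => /le_ceil ceil_le.
  rewrite andTb; suff : k%:Z < U%:Z by rewrite ltz_nat.
  apply: le_lt_trans U_ge; apply: le_trans ceil_le.
  by move/negP: nover; rewrite -leNgt.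
rewrite -natr1; apply: distance_step (multiplier_step D'0 hz' hr rle) pk.
rewrite exprn_ege1// -ler_pdivrMl ?invr_gt0// invrK mulr1.
by move/negP: infeas; rewrite -ltNge => /ltW.
Qed.

Lemma opf_loop_exists n D' I' k z p : cycle_invariant n D' I' k z p ->
  exists z1 p1 r1 cost, opf_loop D' I' k z p z1 p1 r1 cost.
Proof.
have [j] := ubnP (n * U + (U.+1 - k))%N.
elim: j n D' I' k z p => // j IH n D' I' k z p nj inv.
have [[D'0 D'E] _ hz kU _] := inv.
have [z' [r [cost run]]] := opf_pfar_exists p D'0 hz.
have [hz' hr rle _ _] := opf_pfar_spec run (cycle_D D'0 D'E) hz.
have [over|nover] := pselect (cycle_over I' k).
  have [n' nE inv'] := cycle_invariant_new inv hz' over.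
  have [|z1 [p1 [r1 [cost1 run1]]]] := IH _ _ _ _ _ _ _ inv'.
    by apply: leq_trans (iterations_new_cycle n' kU) _; rewrite -nE.
  by exists z1, p1, r1, (add_evals cost cost1); exact: opf_new_cycle run over run1.
have [feas|infeas] := pselect (norm2 (A z' - b) <= eps).
  by exists z', (new_multiplier p z'), r, cost; exact: opf_stop run nover feas.
have inv' := cycle_invariant_next inv hz' hr rle nover infeas.
have [|z1 [p1 [r1 [cost1 run1]]]] := IH _ _ _ _ _ _ _ inv'.
  exact: leq_trans (iterations_next n kU) _.
by exists z1, p1, r1, (add_evals cost cost1); exact: opf_next run nover infeas run1.
Qed.

(** [n * U + (U.+1 - k)] bounds the iterations left: at most [U] in each of the [n]
    cycles to come, and those of the current one. *)
Lemma opf_loop_spec D' I' k z p z1 p1 r1 cost :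
  opf_loop D' I' k z p z1 p1 r1 cost -> forall n, cycle_invariant n D' I' k z p ->
  approx_solution A b psi_s psi_n eps rho z1 p1 r1 /\
  (total_evals cost)%:R <= (n * U + (U.+1 - k))%:R * call_cost.
Proof.
have cost_ge0 : 0 <= call_cost.
  rewrite addr_ge0//; last by rewrite divr_ge0 ?mulr_ge0// ltW.
  by rewrite mulr_ge0// addr_ge0 ?pass_overhead_ge0// !mulr_ge0 ?arl_rate_ge0.
elim=> {D' I' k z p z1 p1 r1 cost}.
- move=> D' I' k z p z' r' cost z1 p1 r1 cost1 run over _ IH n inv.
  have [[D'0 D'E] _ hz kU _] := inv.
  have [hz' hr rle _ hcost] := opf_pfar_spec run (cycle_D D'0 D'E) hz.
  have [n' nE inv'] := cycle_invariant_new inv hz' over.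
  have [approx hcost1] := IH _ inv'; split=> //.
  rewrite total_evals_add; apply: le_trans (lerD hcost hcost1) _.
  by rewrite -[X in X + _]mul1r -mulrDl ler_wpM2r// nat1r ler_nat nE iterations_new_cycle.
- move=> D' I' k z p z' r' cost run nover feas n inv.
  have [[D'0 D'E] _ hz kU _] := inv.
  have [hz' hr rle rrho hcost] := opf_pfar_spec run (cycle_D D'0 D'E) hz.
  split=> //; apply: le_trans hcost _; rewrite ler_peMl// ler1n.
  by rewrite addn_gt0 subn_gt0 ltnS orbC; case/andP: kU => _ ->.
- move=> D' I' k z p z' r' cost z1 p1 r1 cost1 run nover infeas _ IH n inv.
  have [[D'0 D'E] _ hz kU _] := inv.
  have [hz' hr rle _ hcost] := opf_pfar_spec run (cycle_D D'0 D'E) hz.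
  have inv' := cycle_invariant_next inv hz' hr rle nover infeas.
  have [approx hcost1] := IH _ inv'; split=> //.
  rewrite total_evals_add; apply: le_trans (lerD hcost hcost1) _.
  by rewrite -[X in X + _]mul1r -mulrDl ler_wpM2r// nat1r ler_nat iterations_next.
Qed.

End Cycles.

(** * Complexity in terms of the tolerances *)

(** The dependence of all the bounds on the tolerances. *)
Definition tolerance_rate (R : realType) (eps rho : R) : R :=
  Num.sqrt (eps^-1 * Num.max eps^-1 rho^-1).

Lemma tolerance_rate_ge (R : realType) (eps rho : R) : 0 < eps ->
  eps^-1 <= tolerance_rate eps rho.
Proof.
move=> e0; have c0 : 0 <= eps^-1 by rewrite invr_ge0 ltW.
rewrite -[leLHS](ger0_norm c0) -sqrtr_sqr ler_wsqrtr//.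
by rewrite expr2 ler_pM2l ?invr_gt0// le_max lexx.
Qed.

Lemma tolerance_rate_diag (R : realType) (eps : R) : 0 < eps ->
  tolerance_rate eps eps = eps^-1.
Proof.
move=> e0; rewrite /tolerance_rate maxxx -expr2 sqrtr_sqr ger0_norm//.
by rewrite invr_ge0 ltW.
Qed.

Lemma initial_estimate_bounds (R : realType) (E : euclideanType R)
    (psi_s : E -> R) (z0 w0 : E) (Lbar M0 : R) : 0 < Lbar ->
  smooth_convex psi_s Lbar -> w0 <> z0 ->
  initial_estimate psi_s z0 w0 Lbar M0 -> 0 < M0 <= 2 * Lbar.
Proof.
move=> L0 sm wz [[gneq ->]|[]//].
have d0 : 0 < `|z0 - w0| by rewrite normr_gt0 subr_eq0 eq_sym; apply/eqP.
have g0 : 0 < `|grad psi_s z0 - grad psi_s w0|.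
  by rewrite distrC normr_gt0 subr_eq0; apply/eqP.
move: g0 (grad_lipschitz sm z0 w0) d0; move: `|grad psi_s z0 - _| `|z0 - w0| => g d.
move=> g0 gle d0; have d4 : 0 < 4 * d by rewrite mulr_gt0.
have Ld : 0 < Lbar * d by exact: mulr_gt0.
by rewrite divr_gt0//= ler_pdivrMr//; lra.
Qed.

(** The two bracketed factors of the bound are at least [1], and its square root
    dominates a multiple of the tolerance rate. *)
Lemma opf_bound_ge (R : realType) (D D0 P I0 Lbar nA eps rho : R) :
  0 < D0 <= D -> 0 < I0 -> 0 < Lbar -> 0 < nA -> 0 < eps -> 0 < rho ->
  Num.sqrt (nA ^+ 2 * Num.min (D ^+ 2) D) * tolerance_rate eps rho <=
  opf_bound D D0 P I0 Lbar nA eps rho.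
Proof.
move=> /andP[D00 D0D] I00 L0 nA0 e0 r0.
have D_gt0 : 0 < D by exact: lt_le_trans D0D.
have ceilR_ge0 (x : R) : 0 <= x -> 0 <= ceilR x.
  by move=> x0; apply: le_trans x0 (ceil_ge _).
have log_ge0 : 0 <= fine (maxe (log2 (D / D0)) (log2 (P / I0))).
  apply: fine_ge0; rewrite le_max; apply/orP; left; rewrite /log2.
  apply: mule_ge0; last by rewrite lee_fin invr_ge0 ln_ge0// ler1n.
  by rewrite lne_ge0 lee_fin ler_pdivlMr// mul1r.
rewrite /opf_bound.
set a := ceilR _; set b := ceilR _; set q := Num.sqrt (_ * Num.max _ _).
have a0 : 0 <= a by exact: ceilR_ge0.
have b0 : 0 <= b.
  by apply: ceilR_ge0; rewrite le_max divr_ge0 ?mulr_ge0 ?orbT// ltW.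
have q0 : 0 <= q by exact: sqrtr_ge0.
have qle : q <= (1 + a) * (1 + b) * q.
  by rewrite ler_peMl// mulr_ege1// lerDl.
apply: le_trans qle; rewrite /q /tolerance_rate -sqrtrM; last first.
  by rewrite mulr_ge0 ?sqr_ge0// le_min sqr_ge0 ltW.
apply: ler_wsqrtr; set d := Num.min _ _; set X := Num.max eps^-1 rho^-1.
rewrite [leLHS](_ : _ = (nA ^+ 2 / eps) * (d * X)); last by ring.
have d0 : 0 <= d by rewrite le_min sqr_ge0 ltW.
have X0 : 0 <= X by rewrite le_max invr_ge0 ltW.
have nA_eps : 0 <= nA ^+ 2 / eps by rewrite divr_ge0 ?sqr_ge0// ltW.
apply: (ler_pM nA_eps (mulr_ge0 d0 X0)); first by rewrite lerDr ltW.
rewrite /X maxr_pMr// ge_max; apply/andP; split.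
  by rewrite !le_max ler_pM2r ?invr_gt0// ge_min lexx.
by rewrite !le_max ler_pM2r ?invr_gt0// /d ge_min lexx !orbT.
Qed.

Lemma ltz_absS (i : int) : i < (`|i|%N.+1)%:Z.
Proof. lia. Qed.

(** Every constant below is independent of the tolerances: with the penalty
    [eps^-1] the Lipschitz constant is of order [eps^-1], the tolerance of each
    call is of order [min eps rho], and the number of calls is bounded by the
    doublings that the two guesses need. *)
Lemma opf_ial_complexity (R : realType) (E : euclideanType R) (m : nat)
    (A : {linear E -> 'cV[R]_m}) (b : 'cV[R]_m)
    (psi_s : E -> R) (psi_n : E -> \bar R) (Lbar : R)
    (cA : R) (cres : nat) (S : solver E)
    (z0 w0 : E) (p0 : 'cV[R]_m) (M0 I0 : R) :
  0 < Lbar -> smooth_convex psi_s Lbar ->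
  closed_proper_convex psi_n -> compact (dom psi_n) ->
  (exists zs ps, kkt_set A psi_s psi_n zs ps 0 /\ A zs = b) ->
  0 < cA -> solver_spec cA cres S -> dom psi_n z0 -> dom psi_n w0 ->
  w0 <> z0 -> 0 < M0 <= 2 * Lbar -> 0 < I0 ->
  exists2 C : R, 0 < C & forall eps rho : R, 0 < eps <= 1 -> 0 < rho <= 1 ->
  let run := opf_ial S A b psi_s psi_n p0 eps rho eps^-1 M0 `|z0 - w0| I0 z0 in
  (exists z p r n, run z p r n) /\
  (forall z p r n, run z p r n ->
     approx_solution A b psi_s psi_n eps rho z p r /\
     (total_evals n)%:R <= C * tolerance_rate eps rho).
Proof.
move=> L0 psi_s_smooth psi_n_cvx psi_n_compact [zs [ps [kkt zs_b]]] cA0 S_spec.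
move=> hz0 hw0 wz /andP[M00 M0L] I00.
have [K K0 AK] := linear_norm2_bounded A.
set D := diameter (dom psi_n); set D0 := `|z0 - w0|.
have D00 : 0 < D0 by rewrite normr_gt0 subr_eq0 eq_sym; apply/eqP.
have D0D : D0 <= D by exact: dom_bounded.
have D_gt0 : 0 < D by exact: lt_le_trans D0D.
have D0_itv : 0 < D0 <= D by rewrite D00.
have [N N_large] : exists N, D < 2 ^+ N * (4 * D0).
  have [N hN] := exists_pow2_ge (D + 1) (mulr_gt0 (ltr0n R 4) D00).
  by exists N; apply: lt_le_trans hN; rewrite ltrDl.
(* enough doublings to make both guesses of the cycles large *)
have [n1 hn1] := exists_pow2_ge D D00.
have [n2 hn2] := exists_pow2_ge (norm2 (p0 - ps) ^+ 2 + 1) I00.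
pose n := (n1 + n2)%N; pose Dmax := 2 ^+ n * D0; pose Imax := 2 ^+ n * I0.
have pow_ge1 i : 1 <= 2 ^+ i :> R by rewrite exprn_ege1// ler1n.
have Dmax_ge : D <= Dmax.
  apply: le_trans hn1 _; rewrite ler_pM2r// /n exprD ler_peMr// exprn_ge0//.
have Imax_ge : norm2 (p0 - ps) ^+ 2 + 1 <= Imax.
  apply: le_trans hn2 _; rewrite ler_pM2r// /n exprD ler_peMl// exprn_ge0//.
pose U := `|Num.ceil (2 * Imax)|%N.+1.
have U_ge : (Num.ceil (2 * Imax) < U%:Z)%R := ltz_absS _.
pose G := N.+1%:R * (2 * arl_rate cA cres *
    Num.sqrt (28 * D * (Lbar + K ^+ 2) * (4 * Dmax + 1)) + pass_overhead R cres)
  + 12 * (Lbar + K ^+ 2) / M0.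
have Dmax_gt0 : 0 < Dmax by exact: lt_le_trans Dmax_ge.
have LK0 : 0 < Lbar + K ^+ 2 by rewrite ltr_pwDl// sqr_ge0.
have over_ge0 := pass_overhead_ge0 R cres.
have rate_ge0 := arl_rate_ge0 cA cres.
have G_ge0 : 0 <= G.
  rewrite addr_ge0//; last by rewrite divr_ge0 ?mulr_ge0// ltW.
  by rewrite mulr_ge0// addr_ge0// !mulr_ge0.
exists (2 + (n * U + U)%:R * G); first by rewrite ltr_pwDl// mulr_ge0.
move=> eps rho /andP[e0 e1] /andP[r0 r1] run.
have inv : cycle_invariant psi_n ps p0 Dmax Imax U n D0 I0 1 z0 p0.
  exact: cycle_invariant_start.
split.
  have [z [p [r [cost loop]]]] := opf_loop_exists L0 psi_s_smooth psi_n_cvx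
    psi_n_compact cA0 S_spec K0 AK kkt zs_b e0 r0 M00 M0L D0_itv N_large
    Dmax_ge Imax_ge U_ge inv.
  by exists z, p, r, (add_evals (Evals 2 0) cost), cost.
move=> z p r cost [cost' loop ->].
have [approx hcost] := opf_loop_spec L0 psi_s_smooth psi_n_cvx
  psi_n_compact cA0 S_spec K0 AK kkt zs_b e0 r0 M00 M0L D0_itv N_large
  Dmax_ge Imax_ge U_ge loop inv.
split=> //; rewrite total_evals_add.
set Y := tolerance_rate eps rho.
have eY : eps^-1 <= Y by exact: tolerance_rate_ge.
have Y1 : 1 <= Y by apply: le_trans eY; rewrite invf_ge1.
have e1' : 1 <= eps^-1 by rewrite invf_ge1.
have Y0 : 0 <= Y by apply: le_trans Y1.
have Lle : Lbar + eps^-1 * K ^+ 2 <= eps^-1 * (Lbar + K ^+ 2).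
  by rewrite mulrDr lerD2r ler_peMl// ltW.
have costG : call_cost psi_n cA cres Lbar K eps rho M0 N Dmax <= G * Y.
  rewrite /call_cost /G [leRHS]mulrDl; apply: lerD; last first.
    rewrite [leRHS]mulrAC ler_pM2r ?invr_gt0// -[leRHS]mulrA ler_pM2l//.
    by apply: le_trans Lle _; rewrite mulrC ler_pM2l.
  rewrite -[leRHS]mulrA ler_pM2l ?ltr0n// [leRHS]mulrDl.
  apply: lerD; last by rewrite ler_peMr.
  rewrite -[leRHS]mulrA ler_wpM2l ?mulr_ge0// -sqrtrM; last first.
    by rewrite !mulr_ge0 ?addr_ge0 ?mulr_ge0// ltW.
  apply: ler_wsqrtr; set X := Num.max eps^-1 rho^-1.
  have Xe : eps^-1 <= X by rewrite le_max lexx.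
  have Xr : rho^-1 <= X by rewrite le_max lexx orbT.
  rewrite [leRHS](_ : _ = 28 * D * (eps^-1 * (Lbar + K ^+ 2)) * ((4 * Dmax + 1) * X));
    last by ring.
  have DD0 : 0 <= 28 * D by rewrite mulr_ge0// ltW.
  have c0 : 0 <= eps^-1 by exact: le_trans e1'.
  have DL0 : 0 <= 28 * D * (Lbar + eps^-1 * K ^+ 2).
    by rewrite mulr_ge0// addr_ge0 ?mulr_ge0 ?sqr_ge0// ltW.
  have tol0 : 0 <= 4 * Dmax / eps + rho^-1.
    by rewrite addr_ge0 ?invr_ge0 ?mulr_ge0// ltW.
  apply: (ler_pM DL0 tol0); first by rewrite ler_wpM2l.
  by rewrite [leRHS]mulrDl mul1r; apply: lerD => //; rewrite ler_pM2l// mulr_gt0.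
rewrite mulrDl; apply: lerD; first by rewrite ler_peMr.
apply: le_trans hcost _; rewrite subn1 /= -mulrA.
by apply: ler_wpM2l.
Qed.

Theorem theorem2p13 (R : realType) (E : euclideanType R) (m : nat)
    (A : {linear E -> 'cV[R]_m}) (b : 'cV[R]_m)
    (psi_s : E -> R) (psi_n : E -> \bar R) (Lbar D : R)
    (cA : R) (cres : nat) (S : solver E)
    (z0 w0 : E) (p0 : 'cV[R]_m) (M0 I0 : R)
    (A_neq0 : exists z, A z <> 0)
    (Lbar_gt0 : 0 < Lbar)
    (psi_s_smooth : smooth_convex psi_s Lbar)
    (psi_n_cvx : closed_proper_convex psi_n)
    (psi_n_compact : compact (dom psi_n))
    (psi_n_diam : diameter (dom psi_n) = D)
    (kkt : exists zs ps, kkt_set A psi_s psi_n zs ps 0 /\ A zs = b)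
    (cA_gt0 : 0 < cA)
    (S_spec : solver_spec cA cres S)
    (z0_dom : dom psi_n z0)
    (w0_dom : dom psi_n w0)
    (w0_neq : w0 <> z0)
    (M0_init : initial_estimate psi_s z0 w0 Lbar M0)
    (I0_gt0 : 0 < I0) :
  let D0 := `|z0 - w0| in
  let run eps rho :=
    opf_ial S A b psi_s psi_n p0 eps rho eps^-1 M0 D0 I0 z0 in
  (exists2 C : R, 0 < C & forall eps rho : R,
     0 < eps <= 1 -> 0 < rho <= 1 ->
     (exists z p r n, run eps rho z p r n) /\
     (forall z p r n, run eps rho z p r n ->
        approx_solution A b psi_s psi_n eps rho z p r /\
        (total_evals n)%:R <=
          C * opf_bound D D0 (dist2_dual A b psi_s psi_n p0) I0
                Lbar (opnorm A) eps rho)) /\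
  (exists2 C : R, 0 < C & forall eps : R,
     0 < eps <= 1 ->
     (exists z p r n, run eps eps z p r n) /\
     (forall z p r n, run eps eps z p r n ->
        approx_solution A b psi_s psi_n eps eps z p r /\
        (grads n)%:R <= C / eps)).
Proof.
have [C1 C10 HC] := opf_ial_complexity p0 Lbar_gt0 psi_s_smooth psi_n_cvx
  psi_n_compact kkt cA_gt0 S_spec z0_dom w0_dom w0_neq
  (initial_estimate_bounds Lbar_gt0 psi_s_smooth w0_neq M0_init) I0_gt0.
move=> D0 run; have D0_gt0 : 0 < D0.
  by rewrite normr_gt0 subr_eq0 eq_sym; apply/eqP.
have D0D : D0 <= D by rewrite -psi_n_diam; exact: dom_bounded.
have D_gt0 : 0 < D by exact: lt_le_trans D0D.
have nA0 := opnorm_gt0 A_neq0.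
split; last first.
  exists C1 => // eps heps; have [ex all] := HC eps eps heps heps.
  split=> // z p r n /all[approx cost]; split=> //.
  case/andP: heps => e0 _; rewrite tolerance_rate_diag// in cost.
  by apply: le_trans cost; rewrite ler_nat leq_addr.
have s0 : 0 < Num.sqrt (opnorm A ^+ 2 * Num.min (D ^+ 2) D).
  by rewrite sqrtr_gt0 mulr_gt0 ?exprn_gt0// lt_min exprn_gt0.
exists (C1 / Num.sqrt (opnorm A ^+ 2 * Num.min (D ^+ 2) D)); first exact: divr_gt0.
move=> eps rho heps hrho; have [ex all] := HC eps rho heps hrho.
split=> // z p r n /all[approx cost]; split=> //; apply: le_trans cost _.
rewrite -mulrA ler_pM2l// ler_pdivlMl//.
by case/andP: heps => e0 _; case/andP: hrho => r0 _; apply: opf_bound_ge; rewrite ?D0_gt0.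
Qed.
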